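(* The class $\mathcal{SB}_2$ of pairs of partial automorphisms of finite ordered boron trees does not have the weak amalgamation property (WAP).
   Context: Let $\mathcal{T}$ be the class of finite trees with all vertex valencies in $\{1,3\}$. For $T\in\mathcal{T}$, $B(T)$ is the set of leaves of $T$ with $R(a,b,c,d)$ iff $a,b,c,d$ are pairwise distinct and the paths $ab$, $cd$ are disjoint; boron trees are the $(B(T),R)$ together with the one-point structure. For $n$, let $T'_n$ be the graph on $2^{<n}$ (binary sequences of length $<n$) with edges $\{s,si\}$; $T_n$ is obtained by deleting the empty sequence and adding edge $[0,1]$; $B_n=B(T_n)$ with lexicographic order $\le^n$; $\mathrm{meet}(s,t)$ is the longest common initial segment and $\mathrm{ht}$ the length. Given a boron tree $(A,R^A)$ and an $R$-embedding $\phi\colon A\to B_n$, let $<_{lex}^A$ be induced by $\le^n$ and $S^A(a,b,c)$ iff $\phi(a),\phi(b)<^n\phi(c)$ and $\mathrm{ht}(\mathrm{meet}(\phi(a),\phi(b)))>\mathrm{ht}(\mathrm{meet}(\phi(b),\phi(c)))$. Ordered boron trees are the resulting $(A,R^A,S^A,<^A_{lex})$; $\mathcal{SB}$ is their class. $\mathcal{SB}_2$ is the class of $(A,p,q)$ with $A\in\mathcal{SB}$ and $p,q$ partial automorphisms of $A$; embeddings $(A,p,q)\to(B,p',q')$ are embeddings $\phi$ with $\phi p=p'\phi$, $\phi q=q'\phi$. WAP: for every $X$ there are $X'$ and an embedding $\phi\colon X\to X'$ such that for any embeddings $\alpha\colon X'\to Y$, $\beta\colon X'\to Z$ there are $W$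 and embeddings $\gamma\colon Y\to W$, $\delta\colon Z\to W$ with $\gamma\alpha\phi=\delta\beta\phi$. *)

(* Defs.v *)
From HB Require Import structures.
From mathcomp Require Import all_boot all_order.

Set Implicit Arguments.
Unset Strict Implicit.
Unset Printing Implicit Defensive.

Record graph := Graph { vertex :> finType; edge : rel vertex }.

Definition valency (G : graph) (v : G) : nat := #|[pred w | edge v w]|.

(* Since [edge] is symmetric, two adjacent vertices always form a [ucycle] of
   size 2, so acyclicity bounds the size of simple cycles by 2. *)
Definition is_tree (G : graph) : Prop :=
  [/\ 0 < #|G|, symmetric (@edge G), irreflexive (@edge G),
      (forall x y : G, connect (@edge G) x y)
    & (forall c : seq G, ucycle (@edge G) c -> size c <= 2)].

Definition cubic_tree (G : graph) : Prop :=
  is_tree G /\ forall v : G, valency v \in [:: 1; 3].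

(* In a tree the simple path from [a] to [b] exists and is unique. *)
Definition on_path (G : graph) (a b v : G) : Prop :=
  exists p : seq G,
    [/\ path (@edge G) a p, last a p = b, uniq (a :: p) & v \in a :: p].

Definition leaf (G : graph) (v : G) : bool := valency v == 1.

Record rstruct := RStruct {
  rcar :> finType;
  R4 : rcar -> rcar -> rcar -> rcar -> Prop }.

Definition leaves_R (G : graph) (a b c d : {v : G | leaf v}) : Prop :=
  uniq [:: a; b; c; d] /\
  forall v : G, ~ (on_path (val a) (val b) v /\ on_path (val c) (val d) v).

Definition leaves (G : graph) : rstruct := RStruct (@leaves_R G).

Definition r_embedding (A B : rstruct) (f : A -> B) : Prop :=
  injective f /\
  forall a b c d : A, R4 a b c d <-> R4 (f a) (f b) (f c) (f d).

Definition one_point (A : rstruct) : Prop :=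
  #|A| = 1 /\ forall a b c d : A, ~ R4 a b c d.

(* The class is closed under isomorphism. *)
Definition boron_tree (A : rstruct) : Prop :=
  one_point A \/
  exists G : graph, cubic_tree G /\
    exists f : A -> leaves G, r_embedding f /\ bijective f.

(* [{bseq n.-1 of bool}] is the set of binary sequences of length < n (for
   n = 0 it contains the empty sequence, which is discarded in [T_] anyway);
   [false] and [true] stand for 0 and 1. *)
Definition T'_edge (n : nat) : rel {bseq n.-1 of bool} :=
  fun s t => [exists i : bool, (rcons s i == t :> bitseq)
                             || (rcons t i == s :> bitseq)].

Definition T' (n : nat) : graph := Graph (@T'_edge n).

Definition T_edge (n : nat) : rel {s : T' n | (s : bitseq) != [::]} :=
  fun s t =>
    let u : bitseq := val s in let v : bitseq := val t in
    [|| edge (val s) (val t),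
        (u == [:: false]) && (v == [:: true])
      | (u == [:: true]) && (v == [:: false])].

Definition T_ (n : nat) : graph := Graph (@T_edge n).

Definition B_ (n : nat) : rstruct := leaves (T_ n).

Definition B_seq (n : nat) (x : B_ n) : bitseq := val (val (val x)).

Definition B_lt (n : nat) (x y : B_ n) : bool :=
  ((B_seq x : seqlexi bool) < (B_seq y : seqlexi bool))%O.

Fixpoint meet (s t : bitseq) : bitseq :=
  match s, t with
  | i :: s', j :: t' => if i == j then i :: meet s' t' else [::]
  | _, _ => [::]
  end.

Definition ht (s : bitseq) : nat := size s.

Record ostruct := OStruct {
  ored :> rstruct;
  S3 : ored -> ored -> ored -> Prop;
  olt : ored -> ored -> Prop }.

Definition ordered_boron_tree (A : ostruct) : Prop :=
  boron_tree A /\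
  exists (n : nat) (phi : A -> B_ n),
    [/\ r_embedding phi,
        (forall a b : A, olt a b <-> B_lt (phi a) (phi b))
      & (forall a b c : A, S3 a b c <->
           [/\ B_lt (phi a) (phi c), B_lt (phi b) (phi c)
             & ht (meet (B_seq (phi a)) (B_seq (phi b))) >
               ht (meet (B_seq (phi b)) (B_seq (phi c)))])].

Definition o_embedding (A B : ostruct) (f : A -> B) : Prop :=
  [/\ r_embedding f,
      (forall a b c : A, S3 a b c <-> S3 (f a) (f b) (f c))
    & (forall a b : A, olt a b <-> olt (f a) (f b))].

(* An isomorphism between two (possibly empty) induced substructures of [A],
   as a partial function on [A]. *)
Definition partial_aut (A : ostruct) (p : A -> option A) : Prop :=
  [/\ (forall a b a', p a = Some a' -> p b = Some a' -> a = b),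
      (forall a b c d a' b' c' d',
         p a = Some a' -> p b = Some b' -> p c = Some c' -> p d = Some d' ->
         (R4 a b c d <-> R4 a' b' c' d')),
      (forall a b c a' b' c',
         p a = Some a' -> p b = Some b' -> p c = Some c' ->
         (S3 a b c <-> S3 a' b' c'))
    & (forall a b a' b',
         p a = Some a' -> p b = Some b' -> (olt a b <-> olt a' b'))].

Record SB2 := MkSB2 {
  sb_car :> ostruct;
  sb_p : sb_car -> option sb_car;
  sb_q : sb_car -> option sb_car;
  sb_ordered : ordered_boron_tree sb_car;
  sb_p_aut : partial_aut sb_p;
  sb_q_aut : partial_aut sb_q }.

(* f p = p' f on the domain of p; p' may be defined at further points of the
   image of f, so that embeddings can extend partial automorphisms. *)
Definition intertwines (A B : Type) (f : A -> B)
    (p : A -> option A) (p' : B -> option B) : Prop :=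
  forall a a' : A, p a = Some a' -> p' (f a) = Some (f a').

Definition SB2_embedding (X Y : SB2) (f : X -> Y) : Prop :=
  [/\ o_embedding f, intertwines f (@sb_p X) (@sb_p Y)
    & intertwines f (@sb_q X) (@sb_q Y)].

Definition WAP (K : Type) (car : K -> Type)
    (emb : forall X Y : K, (car X -> car Y) -> Prop) : Prop :=
  forall X : K, exists (X' : K) (phi : car X -> car X'),
    emb X X' phi /\
    forall (Y Z : K) (alpha : car X' -> car Y) (beta : car X' -> car Z),
      emb X' Y alpha -> emb X' Z beta ->
      exists (W : K) (gamma : car Y -> car W) (delta : car Z -> car W),
        [/\ emb Y W gamma, emb Z W delta
          & gamma \o alpha \o phi =1 delta \o beta \o phi].

(* Main.v *)
(* A finite ordered boron tree is a set of bit strings of equal length: the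
   order is lexicographic and R, S are read off from the lengths of meets.

   Take points e < a < b with branching order (ea)b, let p fix e and send a to
   b, and let q fix e. The nodes between e and the root form a chain on which
   p and q act as partial order automorphisms. In an extension X' of this
   structure let x be an orbit point of a whose level (branching node with e)
   is highest. As the orbit meets several levels, some generator g or its
   inverse is undefined at the level of x and pushes everything above x upwards,
   so it can be extended to send x to a new leaf n at a level just above x, or
   higher when the images of lower levels require it. The other generator f is
   not defined at n. If f sends some level below n above n (or conversely), then
   f or its inverse can be extended to send n above some point of X' that was
   above the whole orbit; there are finitely many such points, so this happens
   only finitely often. Otherwise f may either fix n or send it to a new leaf
   just above n. As the level of n is given by a word in p, q applied to a, the
   two choices cannot be amalgamated over e and a. *)

Require Import Defs.
From mathcomp Require Import all_boot all_order.
From mathcomp Require Import zify.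

Set Implicit Arguments.
Unset Strict Implicit.
Unset Printing Implicit Defensive.

(** * Meets of bit strings *)

Definition mh (s t : bitseq) : nat := ht (meet s t).

(** The rooted triple [st|u]: [u] branches off before [s] and [t] separate. *)
Definition closer (s t u : bitseq) : bool := mh s u < mh s t.

(** Strict lexicographic order for strings of equal length; a proper prefix does not count as
    smaller. *)
Fixpoint ltb (s t : bitseq) : bool :=
  match s, t with
  | i :: s', j :: t' => if i == j then ltb s' t' else j
  | _, _ => false
  end.

Lemma mh_cons i s j t : mh (i :: s) (j :: t) = if i == j then (mh s t).+1 else 0.
Proof. by rewrite /mh /=; case: ifP. Qed.

Lemma mh0s s : mh [::] s = 0. Proof. by []. Qed.

Lemma mhs0 s : mh s [::] = 0. Proof. by case: s. Qed.

Definition mhE := (mh_cons, mh0s, mhs0).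

Lemma mhC s t : mh s t = mh t s.
Proof.
by elim: s t => [|i s IH] [|j t] //; rewrite !mhE IH eq_sym.
Qed.

Lemma mhss s : mh s s = size s.
Proof. by elim: s => [|i s IH] //=; rewrite mhE eqxx /= IH. Qed.

Lemma mh_sizel s t : mh s t <= size s.
Proof.
elim: s t => [|i s IH] [|j t] //=; rewrite mhE.
by case: ifP => // _; rewrite ltnS.
Qed.

Lemma mh_ultra s t u : minn (mh s t) (mh t u) <= mh s u.
Proof.
elim: s t u => [|i s IH] [|j t] [|k u]; rewrite ?mhE ?minn0 ?min0n //.
case: (eqVneq i j) => [<-|]; last by rewrite min0n.
by case: (eqVneq i k) => // _; rewrite ?minn0 // minnSS ltnS.
Qed.

Lemma mh_eq_size s t : size s = size t -> (mh s t == size s) = (s == t).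
Proof.
elim: s t => [|i s IH] [|j t] //= [/IH]; rewrite mhE eqseq_cons.
by case: (i == j).
Qed.

Lemma mh_lt s t : size s = size t -> s != t -> mh s t < size s.
Proof. by move=> /mh_eq_size <-; rewrite ltn_neqAle mh_sizel andbT. Qed.

(* Two of three bits agree, so three branches cannot separate at one node. *)
Lemma mh_binary s t u :
  mh s t < size s -> mh s t < size t -> mh s u < size u ->
  mh s t = mh s u -> mh s t < mh t u.
Proof.
elim: s t u => [|i s IH] [|j t] [|k u] //; rewrite !mhE /=.
case: (eqVneq i j) => [<-|ij]; case: (eqVneq i k) => [_|ik] //=.
  by rewrite !ltnS => h1 h2 h3 [] /IH; apply.
by move: ij ik; case: i; case: j; case: k.
Qed.

Lemma prefix_meetl s t : prefix (meet s t) s.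
Proof.
elim: s t => [|i s IH] [|j t] //=; case: eqP => // _ /=.
by rewrite eqxx IH.
Qed.

Lemma meetC s t : meet s t = meet t s.
Proof.
by elim: s t => [|i s IH] [|j t] //=; rewrite eq_sym; case: eqP => // ->; rewrite IH.
Qed.

Lemma prefix_meetr s t : prefix (meet s t) t.
Proof. by rewrite meetC prefix_meetl. Qed.

Lemma prefix_mh w s t : prefix w s -> prefix w t -> size w <= mh s t.
Proof.
elim: w s t => [|i w IH] [|j s] [|k t] //=.
by case/andP=> /eqP<- ws /andP[/eqP<- wt]; rewrite mhE eqxx ltnS IH.
Qed.

Lemma prefix_mhE s t : prefix s t = (mh s t == size s).
Proof.
by elim: s t => [|i s IH] [|j t] //=; rewrite mhE IH; case: (i == j).
Qed.

Lemma ltbss s : ltb s s = false.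
Proof. by elim: s => //= i s IH; rewrite eqxx. Qed.

Lemma ltbC s t : size s = size t -> s != t -> ltb s t = ~~ ltb t s.
Proof.
elim: s t => [|i s IH] [|j t] //= [/IH {}IH]; rewrite eqseq_cons.
by case: i; case: j => //=.
Qed.

(** At the node where it leaves [s] the string [t] has bit 1, at the node where it leaves [u] it has
    bit 0, so the nodes differ. *)
Lemma ltb_mid_mh s t u : ltb s t -> ltb t u -> mh s t != mh t u.
Proof.
elim: s t u => [|i s IH] [|j t] [|k u] //=; rewrite !mhE.
by case: i; case: j; case: k => //= *; rewrite eqSS IH.
Qed.

(** [u] leaves at a node that [s] and [t] pass with the same bit, so both compare with [u] in the
    same way. *)
Lemma closer_ltb s t u : closer s t u ->
  ltb s u = ltb t u /\ ltb u s = ltb u t.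
Proof.
rewrite /closer.
elim: s t u => [|i s IH] [|j t] [|k u] //=; rewrite ?mhE //=.
case: (eqVneq i j) => // <-; rewrite [k == i]eq_sym; case: (eqVneq i k) => // _.
by rewrite ltnS => /IH.
Qed.

Lemma closerC s t u : closer s t u = closer t s u.
Proof.
have := mh_ultra s t u; have := mh_ultra t s u; rewrite /closer.
rewrite (mhC t s); lia.
Qed.

Definition sep (s t u : bitseq) : bool := [&& ltb s u, ltb t u & closer t s u].

(** Shows that S and the order determine [closer]. If [u] is right of both strings this is S itself;
    if it is left of both, branching is binary, so [u] splits off first unless it pairs with the
    smaller of [s] and [t]. *)
Lemma closerE s t u : size s = size u -> size t = size u ->
  closer s t u =
    sep s t u || [&& ltb u s, ltb u t, ~~ sep u s t & ~~ sep u t s].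
Proof.
move=> hs ht; apply/idP/idP.
  move=> h; have [h1 h2] := closer_ltb h.
  have sNu : s != u by apply: contraTneq h => ->; rewrite /closer mhss -ht
    -leqNgt mhC mh_sizel.
  rewrite /sep -h1 closerC h andbT -h2 closerC.
  rewrite (ltbC hs sNu) /closer; case: (ltb u s) => //=.
  move: h; rewrite /closer [mh s u]mhC.
  have := mh_ultra s t u; have := mh_ultra u s t; have := mh_ultra u t s.
  rewrite ![mh t s]mhC ![mh u t]mhC ![mh u s]mhC; lia.
case/orP; first by case/and3P; rewrite closerC.
case/and4P=> us ut; rewrite /sep us ut /= => h1 h2.
have [<-|sNt] := eqVneq s t.
  rewrite /closer mhss; apply: mh_lt => //.
  by apply: contraTneq us => ->; rewrite ltbss.
case/boolP: (ltb s t) h1 => [st|/negbTE nst] /=.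
  rewrite /closer -leqNgt leq_eqVlt [mh s u]mhC.
  by rewrite (negbTE (ltb_mid_mh us st)).
have ts : ltb t s by rewrite ltbC ?nst // ?hs ?ht // eq_sym.
move=> _; move: h2; rewrite ts /= closerC [closer s t u]closerC /closer.
rewrite -leqNgt leq_eqVlt.
have := ltb_mid_mh ut ts.
have := mh_ultra t s u; have := mh_ultra t u s; have := mh_ultra u t s.
have := mhC u t; have := mhC u s; have := mhC s t; lia.
Qed.

(** * Quartets of leaves *)

(** Rooted form of the disjointness of the paths [st] and [uv]: the smallest subtree around one of
    the pairs misses the other pair. *)
Definition quartet (s t u v : bitseq) : bool :=
  uniq [:: s; t; u; v] &&
  (closer s t u && closer s t v || closer u v s && closer u v t).

Definition incomp (s t : bitseq) : bool := (mh s t < size s) && (mh s t < size t).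

Lemma closer_cases s t u : incomp s t -> incomp s u -> incomp t u ->
  [|| closer s t u, closer s u t | closer t u s].
Proof.
move=> /andP[h1 h2] /andP[_ h3] _; have := mh_binary h1 h2 h3.
have := mh_ultra s t u; have := mh_ultra t s u; have := mh_ultra s u t.
rewrite /closer (mhC u t) (mhC t s); lia.
Qed.

Lemma quartet_closer s t u v : closer s t u ->
  incomp s t -> incomp s v -> incomp t v ->
  [|| closer s t u && closer s t v, closer s v t && closer s v u
    | closer t v s && closer t v u].
Proof.
move=> stu ist isv itv; have := closer_cases ist isv itv.
have tsu : closer t s u by rewrite closerC.
by move: stu tsu; rewrite /closer (mhC t s); lia.
Qed.

(** Binary branching forces one of the three pairings. This serves to exclude the two wrong ones
    when two paths are disjoint. *)
Lemma quartet_cases s t u v :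
  incomp s t -> incomp s u -> incomp s v -> incomp t u -> incomp t v ->
  incomp u v ->
  [|| closer s t u && closer s t v || closer u v s && closer u v t,
      closer s u t && closer s u v || closer t v s && closer t v u
    | closer s v t && closer s v u || closer t u s && closer t u v].
Proof.
move=> st su sv tu tv uv.
have /or3P[h|h|h] := closer_cases st su tu.
- by have /or3P[] := quartet_closer h st sv tv => ->; rewrite ?orbT.
- have /or3P[] := quartet_closer h su sv uv.
  + by move=> ->; rewrite ?orbT.
  + by rewrite andbC => ->; rewrite ?orbT.
  + by move=> ->; rewrite ?orbT.
- have /or3P[] := quartet_closer h tu tv uv.
  + by move=> ->; rewrite ?orbT.
  + by rewrite andbC => ->; rewrite ?orbT.
  + by rewrite andbC => ->; rewrite ?orbT.
Qed.

(** * Full binary trees without their root *)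

Definition bit_edge (s t : bitseq) : bool :=
  [|| t == rcons s false, t == rcons s true, s == rcons t false,
      s == rcons t true, (s == [:: false]) && (t == [:: true])
    | (s == [:: true]) && (t == [:: false])].

(* The neighbour of a vertex towards the deleted root: its parent, or, for the
   two children of the root, the other child. *)
Definition upward (s : bitseq) : bitseq :=
  if s is [:: b] then [:: ~~ b] else take (size s).-1 s.

Lemma upward_rcons s b : s != [::] -> upward (rcons s b) = s.
Proof.
case: s => [|i [|j s]] // _; rewrite /upward -?[rcons [:: i] b]/[:: i; b] //.
by rewrite size_rcons /= -cats1 take_size_cat.
Qed.

Lemma bit_edgeE s t : s != [::] -> t != [::] ->
  bit_edge s t = [|| t == upward s, t == rcons s false | t == rcons s true].
Proof.
rewrite /bit_edge => s0 t0.
case: (t == rcons s false) => /=; first by rewrite !orbT.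
case: (t == rcons s true) => /=; first by rewrite !orbT.
rewrite !orbF; case/lastP: s s0 => // s b _.
have [->|s0] := eqVneq s [::].
  case: b t t0 => [] [|[] [|j t]] //= _.
rewrite upward_rcons // !eqseq_rcons [s == t]eq_sym.
have hN c : (rcons s b == [:: c]) = false.
  by case: (s) s0 => [|i [|j r]] //; rewrite eqseq_cons andbF.
by rewrite !hN /= !orbF; case: b {hN}; case: (t == s); rewrite ?orbT.
Qed.

Lemma bit_edgeC : symmetric bit_edge.
Proof.
move=> s t; rewrite /bit_edge.
by case: (t == rcons s false); case: (t == rcons s true);
   case: (s == rcons t false); case: (s == rcons t true) => //=;
   rewrite andbC orbC andbC.
Qed.

Lemma bit_edge_irr : irreflexive bit_edge.
Proof.
move=> s; have h b : (s == rcons s b) = false.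
  by apply/eqP => /(congr1 size) /eqP; rewrite size_rcons eqn_leq ltnn andbF.
by rewrite /bit_edge !h /=; case: s {h} => [|[] [|]].
Qed.

Lemma size_upward s : size (upward s) <= size s.
Proof.
case: s => [|i [|j s]] //; rewrite /upward size_take.
by case: ifP => // _; apply: leq_pred.
Qed.

Lemma prefix_of_rcons (m s : bitseq) b :
  prefix m (rcons s b) = (m == rcons s b) || prefix m s.
Proof.
elim: m s => [|i m IH] [|j s] //=; first by rewrite orbF eqseq_cons; case: m {IH}.
by rewrite eqseq_cons IH; case: (i == j).
Qed.

(** The strings extending [m] are joined to the other non-empty strings only by the edge from [m] to
    [upward m]. *)
Lemma bit_edge_prefix m s t : m != [::] -> t != [::] ->
  bit_edge s t -> prefix m s -> ~~ prefix m t -> s = m /\ t = upward m.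
Proof.
move=> m0 t0; rewrite /bit_edge => /or4P[/eqP->|/eqP->|/eqP->|].
- by move=> ms /negP[]; apply: prefix_trans ms _; rewrite prefix_rcons.
- by move=> ms /negP[]; apply: prefix_trans ms _; rewrite prefix_rcons.
- rewrite prefix_of_rcons => /orP[/eqP->|->] // _; by rewrite upward_rcons.
case/or3P=> [/eqP->|/andP[/eqP-> /eqP->]|/andP[/eqP-> /eqP->]].
- rewrite prefix_of_rcons => /orP[/eqP->|->] // _; by rewrite upward_rcons.
- by case: m m0 => [|[] [|? m]].
- by case: m m0 => [|[] [|? m]].
Qed.

(** * Simple paths and a cut vertex *)

Section Cut.

Variables (G : graph) (D : pred G) (m : G).
Hypothesis sym : symmetric (@edge G).
Hypothesis Dm : D m.
Hypothesis cut : forall x y, edge x y -> D x -> ~~ D y -> x = m.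

Lemma path_leaves a p : path (@edge G) a p -> D a -> ~~ D (last a p) ->
  m \in a :: p.
Proof.
elim: p a => [|b p IH] a /=; first by move=> _ ->.
case/andP=> ab bp Da Dl; rewrite inE; have [Db|Db] := boolP (D b).
  by rewrite IH ?orbT.
by rewrite (cut ab Da Db) eqxx.
Qed.

Lemma path_enters a p : path (@edge G) a p -> ~~ D a -> D (last a p) ->
  m \in p.
Proof.
elim: p a => [|b p IH] a /=; first by move=> _ /negbTE->.
case/andP=> ab bp Da Dl; rewrite inE; have [Db|Db] := boolP (D b).
  by rewrite sym in ab; rewrite (cut ab Db Da) eqxx.
by rewrite (IH b) ?orbT.
Qed.

(** A path leaves [D] through [m] and returns through [m], which a simple path cannot visit
    twice. *)
Lemma on_path_stays a b v : D a -> D b -> on_path a b v -> D v.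
Proof.
move=> Da Db [p [ap lp up vp]]; apply/negPn/negP => Dv.
move: vp; rewrite inE => /orP[/eqP va|vp]; first by rewrite va Da in Dv.
case/splitPr: vp ap lp up => p1 p2 ap lp up.
move: ap lp; rewrite cat_path last_cat /= => /and3P[h1 h2 h3] lp.
have := path_enters h3 Dv; rewrite lp => /(_ Db) m2.
have h4 : path (@edge G) a (rcons p1 v) by rewrite rcons_path h1.
have := path_leaves h4 Da; rewrite last_rcons => /(_ Dv).
move: up; rewrite -cat_cons cat_uniq -rcons_cons mem_rcons [m \in v :: _]inE.
case/and3P=> _ /hasPn up _; case: eqP => [mv|_] /= m1.
  by rewrite -mv Dm in Dv.
by have := up m; rewrite inE m2 orbT => /(_ isT) /negP[].
Qed.

End Cut.

(** * Graphs labelled by a prefix-closed set of strings with all siblings *)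

Section BitTree.

Variables (G : graph) (l : G -> bitseq) (P : pred bitseq).
Hypothesis l_inj : injective l.
Hypothesis l_nil : forall x, l x != [::].
Hypothesis l_in : forall x, P (l x).
Hypothesis l_onto : forall s, P s -> s != [::] -> exists x, l x = s.
Hypothesis P_prefix : forall s b, P (rcons s b) -> P s.
Hypothesis P_full : forall s b, P (rcons s b) -> P (rcons s (~~ b)).
Hypothesis edgeE : forall x y : G, edge x y = bit_edge (l x) (l y).

Lemma edge_sym : symmetric (@edge G).
Proof. by move=> x y; rewrite !edgeE bit_edgeC. Qed.

Lemma P_prefix_cat s t : P (s ++ t) -> P s.
Proof.
elim/last_ind: t => [|t b IH]; first by rewrite cats0.
by rewrite -rcons_cat => /P_prefix.
Qed.

Lemma P_le s t : prefix s t -> P t -> P s.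
Proof. by case/prefixP=> u ->; apply: P_prefix_cat. Qed.

Lemma upward_onto x : exists2 y, l y = upward (l x) & edge x y.
Proof.
have [y ly] : exists y, l y = upward (l x).
  apply: l_onto; have := l_in x; have := l_nil x.
    case/lastP: (l x) => // s b _.
    have [->|s0] := eqVneq s [::]; first by apply: (@P_full [::]).
    by rewrite upward_rcons // => /P_prefix.
  by case: (l x) => [|i [|j s]] // _ _; rewrite /upward; case: i.
by exists y => //; rewrite edgeE bit_edgeE // ly eqxx.
Qed.

(** Going upward from any vertex reaches a child of the deleted root, and the two children are
    adjacent. *)
Lemma connect_all x y : connect (@edge G) x y.
Proof.
have csym := sym_connect_sym edge_sym.
have [t lt] : exists t, l t = [:: false].
  have [[] h] : exists b, P [:: b].
    have := l_in x; have := l_nil x; case: (l x) => // b s _.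
    by exists b; apply: (@P_prefix_cat [:: b] s).
  - by apply: l_onto => //; apply: (@P_full [::] true).
  - exact: l_onto.
suff c z : connect (@edge G) z t by rewrite (connect_trans (c x)) // csym.
have [n] := ubnP (size (l z)); elim: n z => // n IH z; rewrite ltnS => zn.
have [w lw zw] := upward_onto z.
have := l_nil z; case/lastP E: (l z) lw zn => [|s b] // lw zn _.
have [s0|s0] := eqVneq s [::].
  move: b E lw {zn}; rewrite s0 => -[] /= E lw.
    have -> : t = w by apply: l_inj; rewrite lt lw.
    exact: connect1.
  by have -> : t = z by apply: l_inj; rewrite lt E.
apply: connect_trans (connect1 zw) (IH w _).
by move: zn; rewrite lw upward_rcons // size_rcons.
Qed.

Lemma highest_neighbour x y : edge x y -> size (l y) <= size (l x) ->
  l y = upward (l x).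
Proof.
rewrite edgeE bit_edgeE // => /or3P[/eqP->|/eqP->|/eqP->] //;
  by rewrite size_rcons ltnn.
Qed.

(** At a vertex of maximal length both neighbours in the cycle are the upward neighbour, so they
    coincide. *)
Lemma bit_tree_acyclic (c : seq G) : ucycle (@edge G) c -> size c <= 2.
Proof.
case/andP=> cc uc; rewrite leqNgt; apply/negP => sc.
have [x0 x0c] : exists x0, x0 \in c.
  by case: (c) sc => // x0 s _; exists x0; rewrite inE eqxx.
case: (@arg_maxnP _ x0 [in c] (fun x => size (l x)) x0c) => x xc xmax.
have [i c' rc] := rot_to xc.
have mem z : z \in x :: c' -> size (l z) <= size (l x).
  by rewrite -rc mem_rot => /xmax.
move: cc uc sc; rewrite -(rot_cycle i) -(rot_uniq i) -(size_rot i) rc.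
case: c' rc mem => [|y c'] // rc mem; case/lastP: c' rc mem => [|c' z] // rc mem.
rewrite /= rcons_path last_rcons => /and3P[xy _ zx] /and3P[_ yNz _] _.
rewrite edge_sym in zx.
have := highest_neighbour xy (mem y _); rewrite !inE eqxx orbT => /(_ isT) ly.
have := highest_neighbour zx (mem z _).
rewrite !inE mem_rcons inE eqxx !orbT => /(_ isT) lz.
by move: yNz; rewrite mem_rcons inE (l_inj (etrans ly (esym lz))) eqxx.
Qed.

Lemma bit_tree_is_tree : 0 < #|G| -> is_tree G.
Proof.
split=> //; [exact: edge_sym| |exact: connect_all|exact: bit_tree_acyclic].
by move=> x; rewrite edgeE bit_edge_irr.
Qed.

Lemma P_rcons s b : P (rcons s b) = P (rcons s false).
Proof. by case: b => //; apply/idP/idP => /P_full. Qed.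

Lemma valencyE x : valency x = if P (rcons (l x) false) then 3 else 1.
Proof.
have [u lu xu] := upward_onto x.
have nilN s b : rcons s b != [::] :> bitseq by case: s.
case: ifP => Px; last first.
  rewrite /valency -(card1 u); apply: eq_card => y; rewrite !inE edgeE bit_edgeE //.
  rewrite -lu (inj_eq l_inj); case: (y == u) => //=.
  by apply/orP; case=> /eqP h; have := l_in y; rewrite h ?[P (rcons _ true)]P_rcons Px.
have [c0 l0] := l_onto Px (nilN _ _).
have [c1 l1] := l_onto (P_full Px) (nilN _ _).
have uc : uniq [:: u; c0; c1].
  have h b y : l y = rcons (l x) b -> u != y.
    move=> ly; apply/eqP => uy; have := size_upward (l x).
    by rewrite -lu uy ly size_rcons ltnn.
  rewrite /= !inE !negb_or (h _ _ l0) (h _ _ l1) !andbT /=.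
  by apply/eqP => c01; move: l1; rewrite -c01 l0 => /eqP; rewrite eqseq_rcons andbF.
rewrite /valency -[3]/(size [:: u; c0; c1]) -(card_uniqP uc).
apply: eq_card => y; rewrite !inE edgeE bit_edgeE //.
by rewrite -lu -l0 -[rcons (l x) true]/(rcons (l x) (~~ false)) -l1 !(inj_eq l_inj).
Qed.

Lemma bit_tree_cubic : 0 < #|G| -> cubic_tree G.
Proof.
move=> G0; split=> [|v]; first exact: bit_tree_is_tree.
by rewrite valencyE; case: ifP.
Qed.

Lemma leafE x : leaf x = ~~ P (rcons (l x) false).
Proof. by rewrite /leaf valencyE; case: ifP. Qed.

Lemma leaf_maximal x s : leaf x -> P s -> prefix (l x) s -> s = l x.
Proof.
rewrite leafE => xl Ps /prefixP[[|b t] e]; first by rewrite cats0 in e.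
move: Ps; rewrite e -cat_rcons => /P_prefix_cat; rewrite P_rcons.
by rewrite (negbTE xl).
Qed.

Lemma leaf_incomp x y : leaf x -> leaf y -> x != y -> incomp (l x) (l y).
Proof.
have h u v : leaf u -> u != v -> mh (l u) (l v) < size (l u).
  move=> ul uv; rewrite ltn_neqAle mh_sizel andbT -prefix_mhE.
  by apply: contra uv => /(leaf_maximal ul (l_in v)) /l_inj->.
by move=> xl yl xy; rewrite /incomp h //= mhC h // eq_sym.
Qed.

(** The subtree at the meet of [a] and [b] hangs on the single edge from [m] to [m']. That [c]
    branches off earlier keeps this meet away from the deleted root. *)
Lemma meet_cut a b c : closer (l a) (l b) c -> exists m : G,
  exists m' : G, [/\ l m = meet (l a) (l b), ~~ prefix (l m) (l m') &
    forall x y, edge x y -> prefix (l m) (l x) -> ~~ prefix (l m) (l y) ->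
      x = m /\ y = m'].
Proof.
move=> abc; have m0 : meet (l a) (l b) != [::].
  by apply: contraTneq abc => e; rewrite /closer [mh (l a) (l b)]/mh e.
have [m lm] := l_onto (P_le (prefix_meetl _ _) (l_in a)) m0.
have [m' lm' _] := upward_onto m; exists m, m'; split=> //.
  rewrite lm'; apply/negP; have := l_nil m.
  case/lastP: (l m) => // s i _; have [->|s0] := eqVneq s [::]; first by case: i.
  by rewrite upward_rcons // => /size_prefix; rewrite size_rcons ltnn.
move=> x y; rewrite edgeE => xy mx my.
have [xm ym] := bit_edge_prefix (l_nil m) (l_nil y) xy mx my.
by split; apply: l_inj; rewrite // lm' ym.
Qed.

Lemma below_meetN a b c : closer (l a) (l b) c -> ~~ prefix (meet (l a) (l b)) c.
Proof.
rewrite /closer ltnNge; apply: contra => /(prefix_mh (prefix_meetl (l a) (l b))).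
by [].
Qed.

Lemma simple_path a b : exists p : seq G,
  [/\ path (@edge G) a p, last a p = b & uniq (a :: p)].
Proof.
have /connectP[p ap ->] := connect_all a b.
by case/shortenP: ap => p' ap' up' _; exists p'.
Qed.

(** The path [ab] stays inside the subtree at the meet of [a] and [b], the path [cd] stays
    outside. *)
Lemma closer_disjoint a b c d v :
  closer (l a) (l b) (l c) -> closer (l a) (l b) (l d) ->
  on_path a b v -> on_path c d v -> False.
Proof.
move=> abc abd abv cdv; have [m [m' [lm mm' cut]]] := meet_cut abc.
pose D := [pred x | prefix (l m) (l x)].
have Da : D a by rewrite /D /= lm prefix_meetl.
have Db : D b by rewrite /D /= lm prefix_meetr.
have Dc : ~~ D c by rewrite /D /= lm below_meetN.
have Dd : ~~ D d by rewrite /D /= lm below_meetN.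
have Dv : D v.
  apply: (on_path_stays edge_sym _ _ Da Db abv) => [|x y xy Dx Dy].
    exact: prefix_refl.
  by have [] := cut x y xy Dx Dy.
suff : ~~ D v by rewrite Dv.
apply: (@on_path_stays _ (predC D) m' edge_sym _ _ c d v) => // x y xy.
rewrite /= negbK edge_sym in xy * => Dx Dy.
by have [] := cut y x xy Dy Dx.
Qed.

(** Both paths leave the subtree at the meet of [a] and [c], and the only way out is through its top
    vertex. *)
Lemma closer_crossing a b c d :
  closer (l a) (l c) (l b) -> closer (l a) (l c) (l d) ->
  exists v, on_path a b v /\ on_path c d v.
Proof.
move=> acb acd; have [m [m' [lm mm' cut]]] := meet_cut acb.
pose D := [pred x | prefix (l m) (l x)].
have cross u v : D u -> ~~ D v -> on_path u v m.
  move=> Du Dv; have [p [up lp uniqp]] := simple_path u v; exists p; split=> //.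
  apply: (path_leaves _ up Du); last by rewrite lp.
  by move=> x y xy Dx Dy; have [] := cut x y xy Dx Dy.
exists m; split; apply: cross; rewrite /D /= lm ?prefix_meetl ?prefix_meetr //.
  exact: below_meetN.
exact: below_meetN.
Qed.

Lemma on_path_sym (a b v : G) : on_path a b v -> on_path b a v.
Proof.
case=> p [ap <- up vp]; exists (rev (belast a p)); split.
- by rewrite rev_path; apply: sub_path ap => x y; rewrite edge_sym.
- by case: p ap up vp => //= b' p _ _ _; rewrite rev_cons last_rcons.
- by rewrite -rev_rcons -lastI rev_uniq.
- by rewrite -rev_rcons -lastI mem_rev.
Qed.

Lemma leaves_RE (a b c d : {v : G | leaf v}) :
  leaves_R a b c d <-> quartet (l (val a)) (l (val b)) (l (val c)) (l (val d)).
Proof.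
pose lv (x : {v : G | leaf v}) := l (val x).
have lv_inj : injective lv by move=> x y /l_inj/val_inj.
rewrite /quartet -[[:: l _; _; _; _]]/(map lv [:: a; b; c; d]).
rewrite map_inj_uniq //; split=> [[u dis]|/andP[u q]]; last first.
  split=> // v [abv cdv]; case/orP: q => /andP[].
    by move=> h1 h2; apply: closer_disjoint h1 h2 abv cdv.
  by move=> h1 h2; apply: closer_disjoint h1 h2 cdv abv.
rewrite u /=.
have inc (x y : {v : G | leaf v}) : x != y -> incomp (l (val x)) (l (val y)).
  by move=> xy; apply: leaf_incomp; rewrite ?(valP x) ?(valP y).
have := quartet_cases.
move=> /(_ (l (val a)) (l (val b)) (l (val c)) (l (val d))).
move: u; rewrite /= !inE !negb_or !andbT.
case/and3P=> /and3P[ab ac ad] /andP[bc bd] cd.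
move=> /(_ (inc _ _ ab) (inc _ _ ac) (inc _ _ ad) (inc _ _ bc) (inc _ _ bd) (inc _ _ cd)).
have no v : @on_path G (val a) (val b) v -> @on_path G (val c) (val d) v -> False.
  by move=> h1 h2; apply: dis (conj h1 h2).
(* The right pairing is the goal; in the four cases of the wrong pairings the two paths cross. *)
case/or3P=> // /orP[]/andP[h1 h2]; exfalso.
- by have [v [h3 h4]] := closer_crossing h1 h2; apply: no h3 h4.
- have [v [h3 h4]] := closer_crossing h1 h2.
  by apply: no (on_path_sym h3) (on_path_sym h4).
- by have [v [h3 h4]] := closer_crossing h1 h2; apply: no h3 (on_path_sym h4).
- by have [v [h3 h4]] := closer_crossing h1 h2; apply: no (on_path_sym h3) h4.
Qed.

End BitTree.

(** * Ordered boron trees as sets of bit strings of equal length *)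

Definition coding (A : ostruct) (k : nat) (c : A -> bitseq) : Prop :=
  [/\ injective c, (forall x, size (c x) = k),
      (forall x y, olt x y <-> ltb (c x) (c y)),
      (forall x y z, S3 x y z <-> sep (c x) (c y) (c z))
    & (forall x y z t, R4 x y z t <-> quartet (c x) (c y) (c z) (c t))].

Lemma ltb_ltxi (s t : bitseq) : size s = size t ->
  (s < t :> seqlexi bool)%O = ltb s t.
Proof.
elim: s t => [|i s IH] [|j t] // [/IH st].
etransitivity; first exact: Order.SeqLexiOrder.ltxi_cons.
by rewrite /= -st; case: i; case: j.
Qed.

(** * The trees [T_ n] as labelled trees *)

Section FullTree.

Variable n : nat.
Let l (x : T_ n) : bitseq := val (val x).
Let P : pred bitseq := fun s => size s <= n.-1.

Lemma T_label_inj : injective l.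
Proof. by move=> x y /val_inj/val_inj. Qed.

Lemma T_label_nil x : l x != [::].
Proof. exact: valP x. Qed.

Lemma T_label_in x : P (l x).
Proof. exact: valP (val x). Qed.

Lemma T_label_onto s : P s -> s != [::] -> exists x, l x = s.
Proof.
move=> Ps s0; have s0' : (Bseq Ps : bitseq) != [::] by [].
by exists (exist _ (Bseq Ps : T' n) s0').
Qed.

Lemma T_prefix s b : P (rcons s b) -> P s.
Proof. by rewrite /P size_rcons => /ltnW. Qed.

Lemma T_full s b : P (rcons s b) -> P (rcons s (~~ b)).
Proof. by rewrite /P !size_rcons. Qed.

Lemma T_edge_bit (x y : T_ n) : edge x y = bit_edge (l x) (l y).
Proof.
rewrite /edge /= /T_edge /bit_edge /edge /= /T'_edge !orbA; congr (_ || _ || _).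
transitivity [exists i : bool, (rcons (l x) i == l y) || (rcons (l y) i == l x)].
  by [].
move: (l x) (l y) => s t.
apply/existsP/idP => [[b /orP[]/eqP<-]|]; try by case: b; rewrite eqxx ?orbT.
case/orP=> [/orP[/orP[]|]|] /eqP h.
- by exists false; rewrite h eqxx.
- by exists true; rewrite h eqxx.
- by exists false; rewrite h eqxx orbT.
- by exists true; rewrite h eqxx orbT.
Qed.

Lemma T_leafE (x : T_ n) : leaf x = (size (l x) == n.-1).
Proof.
rewrite (leafE T_label_inj T_label_nil T_label_in T_label_onto T_prefix T_full
  T_edge_bit) /P size_rcons -leqNgt eqn_leq.
by have := T_label_in x; rewrite /P => ->.
Qed.

Lemma B_RE (a b c d : B_ n) :
  R4 a b c d <-> quartet (B_seq a) (B_seq b) (B_seq c) (B_seq d).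
Proof.
exact: (leaves_RE T_label_inj T_label_nil T_label_in T_label_onto T_prefix
  T_full T_edge_bit).
Qed.

Lemma size_B_seq (a : B_ n) : size (B_seq a) = n.-1.
Proof. by have := valP a; rewrite T_leafE => /eqP. Qed.

Lemma B_seq_onto s : size s = n.-1 -> s != [::] -> exists a : B_ n, B_seq a = s.
Proof.
move=> sn s0; have [|x lx] := T_label_onto _ s0; first by rewrite /P sn.
have xl : leaf x by rewrite T_leafE lx sn.
by exists (exist _ x xl : B_ n); rewrite /B_seq -lx.
Qed.

Lemma B_seq_inj : injective (@B_seq n).
Proof. by move=> a b /T_label_inj/val_inj. Qed.

End FullTree.

(** * Compressing codes to a full binary tree *)

Definition sub_branch (b : bool) (A : seq bitseq) : seq bitseq :=
  [seq behead t | t <- A & ohead t == Some b].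

(* Keeps only the bits at which the strings of [A] branch, so that the prefixes
   of the results form a full binary tree. *)
Fixpoint compress (A : seq bitseq) (s : bitseq) : bitseq :=
  if s is b :: s' then
    let r := compress (sub_branch b A) s' in
    if has (fun t => ohead t == Some (~~ b)) A then b :: r else r
  else [::].

Lemma mem_sub_branch b A s : (s \in sub_branch b A) = (b :: s \in A).
Proof.
apply/mapP/idP => [[t]|h]; last by exists (b :: s); rewrite // mem_filter eqxx.
by rewrite mem_filter => /andP[]; case: t => //= i t /eqP[->] h ->.
Qed.

Lemma size_sub_branch b A k : {in A, forall s, size s = k.+1} ->
  {in sub_branch b A, forall s, size s = k}.
Proof. by move=> Ak s; rewrite mem_sub_branch => /Ak []. Qed.

Lemma has_branch b s (A : seq bitseq) :
  b :: s \in A -> has (fun t => ohead t == Some b) A.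
Proof. by move=> h; apply/hasP; exists (b :: s). Qed.

Lemma size_compress A s : size (compress A s) <= size s.
Proof.
elim: s A => //= b s IH A; case: ifP => _ /=; first by rewrite ltnS.
exact: leqW.
Qed.

(** At the first difference of [s] and [t] both bits occur in [A], so that bit is kept in both
    results. *)
Lemma compress_incomp k A s t : {in A, forall s, size s = k} ->
  s \in A -> t \in A -> s != t -> incomp (compress A s) (compress A t).
Proof.
elim: k A s t => [|k IH] A s t Ak sA tA.
  by move: (Ak _ sA) (Ak _ tA); case: s {sA}; case: t {tA}.
move: (Ak _ sA) (Ak _ tA).
case: s sA => // i s sA _; case: t tA => // j t tA _.
rewrite eqseq_cons /=; have [ij|ij] := eqVneq i j => /= st.
  subst j; have := IH _ s t (size_sub_branch Ak (b := i)).
  rewrite !mem_sub_branch => /(_ sA tA st) h.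
  by case: ifP => // _; move: h; rewrite /incomp mhE eqxx /= !ltnS.
have ej : j = ~~ i by case: i ij {sA}; case: j {tA}.
subst j; rewrite (has_branch tA) negbK (has_branch sA) /incomp mhE.
by rewrite (negbTE ij).
Qed.

(** The bits at which strings separate are kept, so deleting the others does not change which of two
    meets is longer. *)
Lemma compress_closer k A s t u : {in A, forall s, size s = k} ->
  s \in A -> t \in A -> u \in A ->
  closer (compress A s) (compress A t) (compress A u) = closer s t u.
Proof.
elim: k A s t u => [|k IH] A s t u Ak sA tA uA.
  by move: (Ak _ sA) (Ak _ tA) (Ak _ uA); case: s {sA}; case: t {tA}; case: u {uA}.
move: (Ak _ sA) (Ak _ tA) (Ak _ uA).
case: s sA => // i s sA _; case: t tA => // j t tA _; case: u uA => // l u uA _.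
rewrite [RHS]/closer !mhE /=.
have [ij|ij] := eqVneq i j; last first.
  have ej : j = ~~ i by case: i ij {sA}; case: j {tA}.
  subst j; rewrite (has_branch tA) negbK (has_branch sA) ltn0.
  by rewrite /closer [X in _ < X]mhE (negbTE ij) ltn0.
subst j; have [il|il] := eqVneq i l; last first.
  have el : l = ~~ i by case: i il {sA tA}; case: l {uA}.
  subst l; rewrite (has_branch uA) negbK (has_branch sA).
  by rewrite /closer !mhE (negbTE il); case: eqP.
subst l; rewrite ltnS -/(closer s t u).
have := IH _ s t u (size_sub_branch Ak (b := i)).
rewrite !mem_sub_branch => /(_ sA tA uA) <-.
by case: ifP => // _; rewrite /closer !mhE; case: eqP.
Qed.

(** A bit is kept only if some string of [A] takes the other branch; that string provides [t]. *)
Lemma compress_full k A s w b : {in A, forall s, size s = k} -> s \in A ->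
  prefix (rcons w b) (compress A s) ->
  exists2 t, t \in A & prefix (rcons w (~~ b)) (compress A t).
Proof.
elim: k A s w => [|k IH] A s w Ak sA.
  by move: (Ak _ sA); case: s {sA} => // _; case: w.
move: (Ak _ sA); case: s sA => // i s sA _ /=.
have sub v : prefix (rcons v b) (compress (sub_branch i A) s) -> exists2 t,
    i :: t \in A & prefix (rcons v (~~ b)) (compress (sub_branch i A) t).
  move=> /(IH _ _ _ (size_sub_branch Ak (b := i))).
  by rewrite mem_sub_branch => /(_ sA) [t]; rewrite mem_sub_branch; exists t.
case: ifP => [h|h] ws; last first.
  by have [t tA wt] := sub _ ws; exists (i :: t); rewrite //= h.
case: w ws => [|j w] /=.
  rewrite prefix0s andbT => /eqP->; have /hasP[] := h.
  case=> // j t tA /= /eqP[ej]; subst j; exists (~~ i :: t) => //=.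
  by rewrite negbK (has_branch sA) /= ?eqxx ?prefix0s.
case/andP=> /eqP-> /sub [t tA wt]; exists (i :: t) => //=.
by rewrite h /= eqxx.
Qed.

(** * The cubic tree with a given coded set as leaves *)

Section Coded.

Variables (T : finType) (k : nat) (c : T -> bitseq).
Hypothesis c_inj : injective c.
Hypothesis c_size : forall x, size (c x) = k.

Let A : seq bitseq := codom c.

Lemma codom_size : {in A, forall s, size s = k}.
Proof. by move=> s /codomP[x ->]. Qed.

Definition tree_label (x : T) : bitseq := compress A (c x).

Definition tree_domain : pred bitseq :=
  fun s => [exists x, prefix s (tree_label x)].

(** As in [T_ n] the root of the binary tree is left out and its children are joined. The bound [k]
    on the length makes the vertices a finite type. *)
Definition coded_graph : graph :=
  @Graph {s : {bseq k of bool} | tree_domain s && (s != [::] :> bitseq)}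
    (fun s t => bit_edge (val (val s)) (val (val t))).

Let l (v : coded_graph) : bitseq := val (val v).

Lemma coded_graph_inj : injective l.
Proof. by move=> x y /val_inj/val_inj. Qed.

Lemma coded_graph_nil x : l x != [::].
Proof. by have /andP[] := valP x. Qed.

Lemma coded_graph_in x : tree_domain (l x).
Proof. by have /andP[] := valP x. Qed.

Lemma coded_graph_onto s : tree_domain s -> s != [::] -> exists x, l x = s.
Proof.
move=> Ps s0; have sk : size s <= k.
  have /existsP[x /size_prefix h] := Ps.
  by apply: leq_trans h _; rewrite -(c_size x) size_compress.
have h : tree_domain (Bseq sk) && ((Bseq sk : bitseq) != [::]) by rewrite Ps.
by exists (exist _ (Bseq sk) h).
Qed.

Lemma tree_domain_prefix s b : tree_domain (rcons s b) -> tree_domain s.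
Proof.
case/existsP=> x h; apply/existsP; exists x.
by apply: prefix_trans h; rewrite prefix_rcons.
Qed.

Lemma tree_domain_full s b :
  tree_domain (rcons s b) -> tree_domain (rcons s (~~ b)).
Proof.
case/existsP=> x /(compress_full codom_size (codom_f c x)) [_ /codomP[y ->] h].
by apply/existsP; exists y.
Qed.

Lemma coded_graph_edge (x y : coded_graph) : edge x y = bit_edge (l x) (l y).
Proof. by []. Qed.

Lemma tree_label_incomp x y : x != y -> incomp (tree_label x) (tree_label y).
Proof.
by move=> xy; apply: (compress_incomp codom_size);
  rewrite ?codom_f // (inj_eq c_inj).
Qed.

Lemma tree_label_closer x y z :
  closer (tree_label x) (tree_label y) (tree_label z) = closer (c x) (c y) (c z).
Proof. by apply: (compress_closer codom_size); rewrite codom_f. Qed.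

Lemma tree_label_inj : injective tree_label.
Proof.
move=> x y h; apply/eqP/negPn/negP => /tree_label_incomp.
by rewrite /incomp h mhss ltnn.
Qed.

Lemma quartet_tree_label x y z t :
  quartet (tree_label x) (tree_label y) (tree_label z) (tree_label t) =
  quartet (c x) (c y) (c z) (c t).
Proof.
by rewrite /quartet !tree_label_closer /= !inE !(inj_eq c_inj) !(inj_eq tree_label_inj).
Qed.

Let leafP := leafE coded_graph_inj coded_graph_nil coded_graph_in
  coded_graph_onto tree_domain_prefix tree_domain_full coded_graph_edge.

Hypothesis T_gt1 : 1 < #|T|.

Lemma tree_label_nil x : tree_label x != [::].
Proof.
have [y xy] : exists y, x != y.
  apply/existsP; apply: contraLR T_gt1; rewrite negb_exists -leqNgt => /forallP h.
  rewrite -(card1 x); apply: subset_leq_card; apply/subsetP => y _.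
  by rewrite inE eq_sym; have := h y; rewrite negbK.
by apply/eqP => h; have := tree_label_incomp xy; rewrite /incomp h andbC ltn0 andbF.
Qed.

Lemma coded_leaf x : exists v : leaves coded_graph, l (val v) = tree_label x.
Proof.
have [|v lv] := coded_graph_onto _ (tree_label_nil x).
  by apply/existsP; exists x; apply: prefix_refl.
have vl : leaf v.
  rewrite leafP; apply/negP => /existsP[y]; rewrite lv => h.
  have := size_prefix h; rewrite size_rcons.
  have [<-|/tree_label_incomp] := eqVneq x y; first by rewrite ltnn.
  have := prefix_trans (prefix_rcons _ _) h; rewrite prefix_mhE /incomp => /eqP->.
  by rewrite ltnn.
by exists (exist _ v vl : leaves coded_graph).
Qed.

Lemma leaf_coded (v : leaves coded_graph) : exists x, tree_label x = l (val v).
Proof.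
have /existsP[x h] := coded_graph_in (val v); exists x.
apply: (leaf_maximal coded_graph_inj coded_graph_nil coded_graph_in
  coded_graph_onto tree_domain_prefix tree_domain_full coded_graph_edge) h.
  exact: valP v.
by apply/existsP; exists x; apply: prefix_refl.
Qed.

Lemma coded_boron (R : T -> T -> T -> T -> Prop) :
  (forall x y z t, R x y z t <-> quartet (c x) (c y) (c z) (c t)) ->
  boron_tree (RStruct R).
Proof.
move=> RE; right; exists coded_graph; split.
  apply: (bit_tree_cubic coded_graph_inj coded_graph_nil coded_graph_in
    coded_graph_onto tree_domain_prefix tree_domain_full coded_graph_edge).
  have /card_gt0P[x _] : 0 < #|T| by apply: ltnW.
  by have [v _] := coded_leaf x; apply/card_gt0P; exists (val v).
have [f fP] := fin_all_exists coded_leaf.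
have [g gP] := fin_all_exists leaf_coded.
have f_inj : injective f.
  by move=> x y fxy; apply: tree_label_inj; rewrite -!fP fxy.
exists f; split; last first.
  exists g => [x|v]; first by apply: tree_label_inj; rewrite gP fP.
  by apply/val_inj/coded_graph_inj; rewrite -/l fP gP.
split=> // x y z t; rewrite /= RE -quartet_tree_label -!fP; split.
  by move/(leaves_RE coded_graph_inj coded_graph_nil coded_graph_in
    coded_graph_onto tree_domain_prefix tree_domain_full coded_graph_edge).
by move/(leaves_RE coded_graph_inj coded_graph_nil coded_graph_in
    coded_graph_onto tree_domain_prefix tree_domain_full coded_graph_edge).
Qed.

End Coded.

(** The class asks for a cubic tree with leaf set [A], built from the compressed codes, and for an
    embedding into some [B_ n], given by the codes themselves. *)
Lemma coding_ordered (A : ostruct) k (c : A -> bitseq) :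
  0 < #|A| -> coding k.+1 c -> ordered_boron_tree A.
Proof.
move=> A0 [c_inj c_size cO cS cR]; split.
  have [A1|A1] := leqP #|A| 1.
    have {}A1 : #|A| = 1 by apply/eqP; rewrite eqn_leq A1.
    left; split=> // x y z t /cR /andP[].
    have /fintype_le1P h : #|A| <= 1 by rewrite A1.
    by rewrite (h x y) /= !inE eqxx.
  by case: A A1 c c_inj c_size cR {A0 cO cS} => [[T R] S O] /= T1 c *;
    apply: (coded_boron (k := k.+1) (c := c)).
(* Leaves of [T_ n] have length [n.-1], so codes of length [k.+1] need [n = k.+2]. *)
have lift x : exists a : B_ k.+2, B_seq a = c x.
  apply: B_seq_onto; rewrite ?c_size //; apply/eqP => e.
  by have := c_size x; rewrite e.
have [f fP] := fin_all_exists lift; exists k.+2, f; split.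
- split=> [x y fxy|x y z t]; first by apply: c_inj; rewrite -!fP fxy.
  by rewrite cR B_RE !fP.
- by move=> x y; rewrite cO /B_lt ltb_ltxi ?size_B_seq // !fP.
- move=> x y z; rewrite cS /sep /B_lt !ltb_ltxi ?size_B_seq // !fP /closer.
  by rewrite [mh (c y) (c x)]mhC; split=> [/and3P|h]; [|apply/and3P].
Qed.

Lemma ordered_coding (A : ostruct) (x : A) : ordered_boron_tree A ->
  exists k (c : A -> bitseq), coding k.+1 c.
Proof.
case=> _ [n [f [[f_inj fR] fO fS]]].
(* [x] provides a leaf, whose string is non-empty; hence [n.-1] is positive. *)
have n1 : n.-1 = n.-1.-1.+1.
  rewrite prednK // -(size_B_seq (f x)) lt0n size_eq0.
  exact: (T_label_nil (val (f x))).
exists n.-1.-1, (fun y => B_seq (f y)); split.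
- by move=> y z /B_seq_inj/f_inj.
- by move=> y; rewrite size_B_seq.
- by move=> y z; rewrite fO /B_lt ltb_ltxi // !size_B_seq.
- move=> y z t; rewrite fS /sep /B_lt !ltb_ltxi ?size_B_seq // /closer.
  by rewrite [mh (B_seq (f z)) (B_seq (f y))]mhC; split=> [/and3P|h]; [|apply/and3P].
- by move=> y z t u; rewrite fR B_RE.
Qed.

(** * Adding a leaf *)

(* Makes room for a new node just above the subtree of strings extending [u];
   the other strings are padded to keep all lengths equal. *)
Fixpoint grow (b : bool) (u s : bitseq) : bitseq :=
  match u, s with
  | [::], _ => ~~ b :: s
  | i :: u', j :: s' => if i == j then j :: grow b u' s' else rcons s false
  | _ :: _, [::] => [:: false]
  end.

Lemma size_grow b u s : size (grow b u s) = (size s).+1.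
Proof.
elim: u s => [|i u IH] [|j s] //=; case: ifP => _ /=; first by rewrite IH.
by rewrite size_rcons.
Qed.

Lemma mh_rcons s t b : size s = size t ->
  mh (rcons s b) (rcons t b) = mh s t + (s == t).
Proof.
elim: s t => [|i s IH] [|j t] //=; first by rewrite mhE eqxx.
by case=> /IH {}IH; rewrite !mhE eqseq_cons IH; case: eqP.
Qed.

(** The inserted bit is shared by the strings extending [u]; the padding lengthens only the meet of
    a string with itself. *)
Lemma mh_grow b u s t : size s = size t -> size u <= size s ->
  mh (grow b u s) (grow b u t) =
    mh s t + (prefix u s && prefix u t || (s == t)).
Proof.
elim: u s t => [|i u IH] s t st.
  by rewrite !prefix0s /= mhE eqxx addn1.
case: s t st => [|j s] [|k t] // [st]; rewrite ltnS => us /=.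
have {}IH := IH s t st us.
have [ij|ij] := eqVneq i j; have [ik|ik] := eqVneq i k; rewrite /= ?andbF /=.
- by rewrite -ij -ik !mhE eqseq_cons !eqxx /= IH.
- have jk : (j == k) = false by rewrite -ij (negbTE ik).
  by rewrite !mhE eqseq_cons jk.
- have jk : (j == k) = false by rewrite eq_sym -ik (negbTE ij).
  by rewrite !mhE eqseq_cons jk.
have jk : j = k by case: i ij ik {IH}; case: j; case: k.
by rewrite !mhE eqseq_cons jk !eqxx mh_rcons.
Qed.

Lemma ltb_rcons s t b : size s = size t -> ltb (rcons s b) (rcons t b) = ltb s t.
Proof.
elim: s t => [|i s IH] [|j t] //=; first by rewrite eqxx.
by case=> /IH->.
Qed.

Lemma ltb_grow b u s t : size s = size t -> size u <= size s ->
  ltb (grow b u s) (grow b u t) = ltb s t.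
Proof.
elim: u s t => [|i u IH] s t st; first by rewrite /= eqxx.
case: s t st => [|j s] [|k t] // [st]; rewrite ltnS => us /=.
have {}IH := IH s t st us.
have [ij|ij] := eqVneq i j; have [ik|ik] := eqVneq i k => /=.
- by rewrite IH.
- by rewrite -ij (negbTE ik).
- by rewrite -ik eq_sym (negbTE ij).
by rewrite ltb_rcons.
Qed.

Lemma mh_grow_new b u s r : size u <= size s ->
  mh (grow b u s) (u ++ b :: r) = mh s u.
Proof.
elim: u s => [|i u IH] [|j s] //=; rewrite ?mhE //; try by case: b.
rewrite ltnS => us; rewrite [j == i]eq_sym; case: (eqVneq i j) => ij.
  by rewrite -ij mhE eqxx IH.
by rewrite mhE eq_sym (negbTE ij).
Qed.

Lemma ltb_grow_new b u s r : size u <= size s -> prefix u s ->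
  ltb (grow b u s) (u ++ b :: r) = b.
Proof.
elim: u s => [|i u IH] [|j s] //=; try by case: b.
by rewrite ltnS => us /andP[/eqP<- us']; rewrite eqxx /= eqxx IH.
Qed.

Lemma mh_take h s t : h <= size t -> mh s (take h t) = minn h (mh s t).
Proof.
elim: h s t => [|h IH] [|i s] [|j t] //=; rewrite ?mhE ?min0n ?minn0 //.
by rewrite ltnS => /IH; case: ifP => _ => [->|]; rewrite ?minnSS ?minn0.
Qed.

(** The new leaf leaves the way from [e] to the root just above the meet of [e] and [v], on the side
    given by [b]: it is further from [e] than everything up to the level of [v] and nearer than
    everything beyond. *)
Lemma new_leaf (T : finType) (k : nat) (c : T -> bitseq) (e v : T) (b : bool) :
  injective c -> (forall x, size (c x) = k) ->
  exists c' : option T -> bitseq,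
    [/\ injective c', (forall x, size (c' x) = k.+1),
        (forall x y, ltb (c' (Some x)) (c' (Some y)) = ltb (c x) (c y)),
        (forall x y z, closer (c' (Some x)) (c' (Some y)) (c' (Some z))
                       = closer (c x) (c y) (c z))
      & ltb (c' (Some e)) (c' None) = b /\ forall y,
        closer (c' (Some e)) (c' (Some y)) (c' None)
          = ~~ closer (c e) (c v) (c y)
        /\ closer (c' (Some e)) (c' None) (c' (Some y))
          = closer (c e) (c v) (c y)].
Proof.
move=> c_inj c_size; pose h := mh (c e) (c v).
have hk : h <= k by rewrite -(c_size e) mh_sizel.
pose u := take h (c e).
have su : size u = h by rewrite size_takel // c_size.
(* The padding brings the length to [k.+1], that of the grown codes. *)
pose nw := u ++ b :: nseq (k - h) false.
pose c' x := if x is Some y then grow b u (c y) else nw.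
have us x : size u <= size (c x) by rewrite su c_size.
have sxy x y : size (c x) = size (c y) by rewrite !c_size.
have mhu y : mh (c y) u = minn h (mh (c e) (c y)).
  by rewrite mh_take ?c_size // mhC.
have pu y : prefix u (c y) = (h <= mh (c e) (c y)).
  rewrite prefix_mhE su mhC mhu; lia.
have c'lt x y : ltb (c' (Some x)) (c' (Some y)) = ltb (c x) (c y).
  by rewrite /= ltb_grow.
have c'mh x y : mh (c' (Some x)) (c' (Some y)) = mh (c x) (c y) +
    ((h <= mh (c e) (c x)) && (h <= mh (c e) (c y)) || (c x == c y)).
  by rewrite /= mh_grow // !pu.
have c'new y : mh (c' (Some y)) (c' None) = minn h (mh (c e) (c y)).
  by rewrite /= mh_grow_new // mhu.
have c'size x : size (c' x) = k.+1.
  case: x => [x|] /=; first by rewrite size_grow c_size.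
  by rewrite size_cat su /= size_nseq addnS subnKC.
have newN y : c' (Some y) <> c' None.
  move=> cy; have := c'new y; rewrite cy mhss c'size; lia.
have eqk x y : (c x == c y) = (k <= mh (c x) (c y)).
  by rewrite -(mh_eq_size (sxy x y)) eqn_leq mh_sizel c_size.
exists c'; split=> // [[x|] [y|]|x y z|].
- move=> cxy; congr Some; apply: c_inj; apply/eqP/negPn/negP => xy.
  have := ltbC (sxy x y) xy; rewrite -!c'lt cxy ltbss //.
- by move/newN.
- by move/esym/newN.
- by [].
- rewrite /closer !c'mh.
  have := mh_ultra (c x) (c e) (c y); have := mh_ultra (c e) (c x) (c y).
  have := mh_ultra (c x) (c e) (c z); have := mh_ultra (c e) (c x) (c z).
  have := mh_ultra (c e) (c y) (c x); have := mh_ultra (c e) (c z) (c x).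
  have := mhC (c e) (c x); have := mhC (c y) (c x); have := mhC (c z) (c x).
  have := mh_sizel (c x) (c y); have := mh_sizel (c x) (c z).
  rewrite !eqk c_size; lia.
split; first by rewrite /= ltb_grow_new // pu mhss c_size.
have ee : mh (c e) (c e) = k by rewrite mhss c_size.
move=> y; rewrite /closer !c'new !c'mh ee.
have := mh_sizel (c e) (c y); rewrite eqk c_size -/h; split; lia.
Qed.

(** * Extending partial isomorphisms by one pair *)

(** A relation treats a partial map and its inverse alike. S and R are read off from the order and
    [closer], and the order, being preserved both ways, makes [G] a partial injection on coded
    points. *)
Definition preserves (T : Type) (c : T -> bitseq) (G : rel T) : Prop :=
  forall x x' y y', G x x' -> G y y' ->
    ltb (c x) (c y) = ltb (c x') (c y') /\
    forall z z', G z z' ->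
      closer (c x) (c y) (c z) = closer (c x') (c y') (c z').

(** The branch points of [s] and [t] with [e] both differ from that of [x], so each triple with [x]
    reduces to triples through [e]. *)
Lemma closer_via (e x s t : bitseq) : mh e s != mh e x -> mh e t != mh e x ->
  closer s t x = (if closer e s x then closer e t x
                  else ~~ closer e t x && closer s t e) /\
  closer s x t = (if closer e s x then ~~ closer e t x else closer s e t).
Proof.
have := mh_ultra s e t; have := mh_ultra e s t; have := mh_ultra e t s.
have := mh_ultra s e x; have := mh_ultra e s x; have := mh_ultra e x s.
have := mh_ultra t e x; have := mh_ultra e t x; have := mh_ultra e x t.
have := mh_ultra s t x; have := mh_ultra t s x.
rewrite /closer ?(mhC s e) ?(mhC t e) ?(mhC x s) ?(mhC x t) ?(mhC x e) ?(mhC t s).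
by case: ifP; split; lia.
Qed.

(** Since [e] is fixed, the pair of [x] and [n] may be added once [n] lies on the same side of [e]
    as [x], its level cuts the images as the level of [x] cuts the domain, and no domain or image
    point lies on these levels. *)
Lemma preserves_add (T : eqType) (k : nat) (c : T -> bitseq) (G : rel T) (e x n : T) :
  injective c -> (forall y, size (c y) = k) -> preserves c G -> G e e ->
  ltb (c e) (c x) = ltb (c e) (c n) ->
  (forall z w, G z w ->
     [/\ closer (c e) (c z) (c x) = closer (c e) (c w) (c n),
         closer (c e) (c x) (c z) = ~~ closer (c e) (c z) (c x)
       & closer (c e) (c n) (c w) = ~~ closer (c e) (c w) (c n)]) ->
  preserves c [rel z w | G z w || (z == x) && (w == n)].
Proof.
move=> c_inj c_size pG ee lxn H.
have NN y : closer (c e) (c y) (c e) = false.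
  by rewrite /closer mhss c_size ltnNge -(c_size e) mh_sizel.
have ltN y : closer (c e) (c e) (c y) -> ltb (c y) (c e) = ~~ ltb (c e) (c y).
  move=> h; apply: ltbC; first by rewrite !c_size.
  by apply: contraTneq h => ->; rewrite NN.
have lxn' : ltb (c x) (c e) = ltb (c n) (c e).
  have [ex _ _] := H _ _ ee; have [_ h1 h2] := H _ _ ee.
  by rewrite !ltN ?lxn // -?ex; move: h1 h2; rewrite !NN /=; case: closer.
have neq z w : G z w -> mh (c e) (c z) != mh (c e) (c x) /\
                         mh (c e) (c w) != mh (c e) (c n).
  by move=> /H[_]; rewrite /closer; lia.
(* If [z] is nearer to [e] than [x], it compares with [x] as [e] does; otherwise [x] compares with
   [z] as [e] does. *)
have lt1 z w : G z w -> ltb (c z) (c x) = ltb (c w) (c n) /\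
                         ltb (c x) (c z) = ltb (c n) (c w).
  move=> zw; have [h1 h2 h3] := H _ _ zw; have [l1 _] := pG _ _ _ _ zw ee.
  have [l2 _] := pG _ _ _ _ ee zw.
  case: (boolP (closer (c e) (c z) (c x))) h1 h2 h3 => hz /esym hw.
    by rewrite hw; have [<- <-] := closer_ltb hz; have [<- <-] := closer_ltb hw.
  rewrite hw /= => /closer_ltb[h5 h6] /closer_ltb[h7 h8].
  by rewrite -h5 -h6 -h7 -h8 l1 l2.
have c3 z z' w w' : G z z' -> G w w' ->
    closer (c z) (c w) (c x) = closer (c z') (c w') (c n) /\
    closer (c z) (c x) (c w) = closer (c z') (c n) (c w').
  move=> zz ww; have [nz nz'] := neq _ _ zz; have [nw nw'] := neq _ _ ww.
  have [-> ->] := closer_via nz nw; have [-> ->] := closer_via nz' nw'.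
  have [-> _ _] := H _ _ zz; have [-> _ _] := H _ _ ww.
  have [_ h1] := pG _ _ _ _ zz ww; have [_ h2] := pG _ _ _ _ zz ee.
  by rewrite (h1 _ _ ee) (h2 _ _ ww).
have c2 z w : G z w -> closer (c x) (c x) (c z) /\ closer (c n) (c n) (c w).
  move=> /neq[h1 h2].
  rewrite /closer !mhss !c_size -{1}(c_size x) -(c_size n).
  split; apply: mh_lt; rewrite ?c_size //.
    by apply: contraNneq h1 => ->.
  by apply: contraNneq h2 => ->.
move=> z z' w w' /= /orP[zz|/andP[/eqP-> /eqP->]] /orP[ww|/andP[/eqP-> /eqP->]].
- have [l1 h] := pG _ _ _ _ zz ww; split=> // y y' /orP[/h//|/andP[/eqP-> /eqP->]].
  by have [] := c3 _ _ _ _ zz ww.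
- have [l1 _] := lt1 _ _ zz; split=> // y y' /orP[yy|/andP[/eqP-> /eqP->]].
    by have [] := c3 _ _ _ _ zz yy.
  by rewrite /closer !ltnn.
- have [_ l1] := lt1 _ _ ww; split=> // y y' /orP[yy|/andP[/eqP-> /eqP->]].
    by rewrite closerC [RHS]closerC; have [] := c3 _ _ _ _ ww yy.
  by rewrite closerC [RHS]closerC /closer !ltnn.
- split=> [|y y' /orP[yy|/andP[/eqP-> /eqP->]]]; first by rewrite !ltbss.
    by have [-> ->] := c2 _ _ yy.
  by rewrite /closer !ltnn.
Qed.

(** * Systems of two partial automorphisms *)

(** Concrete form of the objects of [SB2]: [gen true] is p and [gen false] is q, as relations. *)
Record coded_system := CodedSystem {
  point :> finType;
  width : nat;
  code : point -> bitseq;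
  code_inj : injective code;
  code_size : forall x, size (code x) = width.+1;
  gen : bool -> rel point;
  gen_pres : forall b, preserves code (gen b) }.

Definition before (Y : coded_system) (x y : Y) : bool := ltb (code x) (code y).

Definition cl (Y : coded_system) (x y z : Y) : bool :=
  closer (code x) (code y) (code z).

Definition sys_emb (Y Z : coded_system) (f : Y -> Z) : Prop :=
  [/\ forall x y, before (f x) (f y) = before x y,
      forall x y z, cl (f x) (f y) (f z) = cl x y z
    & forall b x y, gen b x y -> gen b (f x) (f y)].

Lemma sys_emb_comp (X Y Z : coded_system) (f : X -> Y) (g : Y -> Z) :
  sys_emb f -> sys_emb g -> sys_emb (g \o f).
Proof.
case=> f1 f2 f3 [g1 g2 g3]; split=> [x y|x y z|b x y h] /=.
- by rewrite g1.
- by rewrite g2.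
- exact/g3/f3.
Qed.

(* [cl e x y] also says that the branch point of [y] on the way from the leaf
   [e] to the root lies above that of [x]. *)
Definition level (Y : coded_system) (e x : Y) : nat := mh (code e) (code x).

Definition same (Y : coded_system) (e x y : Y) : bool := level e x == level e y.

Lemma clE (Y : coded_system) (e x y : Y) : cl e x y = (level e y < level e x).
Proof. by []. Qed.

Lemma sameE (Y : coded_system) (e x y : Y) : same e x y = ~~ cl e x y && ~~ cl e y x.
Proof. rewrite !clE /same; lia. Qed.

(** Its components are the orbits up to level: they are generated by p, q, their inverses and moves
    between points of equal level. *)
Definition step (Y : coded_system) (e : Y) : rel Y :=
  fun x y => same e x y || [exists b, gen b x y || gen b y x].

Lemma step_sym (Y : coded_system) (e : Y) : symmetric (step e).
Proof.
move=> x y; rewrite /step /same eq_sym; congr (_ || _).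
by apply: eq_existsb => b; rewrite orbC.
Qed.

Lemma step_csym (Y : coded_system) (e : Y) : connect_sym (step e).
Proof. exact: sym_connect_sym (@step_sym Y e). Qed.

Lemma step_gen (Y : coded_system) (e : Y) b x y : gen b x y -> step e x y.
Proof. by move=> h; apply/orP; right; apply/existsP; exists b; rewrite h. Qed.

Definition dir (T : Type) (d : bool) (R : rel T) : rel T :=
  fun x y => if d then R x y else R y x.

Lemma step_dir (Y : coded_system) (e : Y) b d x y :
  dir d (gen b) x y -> step e x y.
Proof. by case: d => h; [|rewrite step_sym]; exact: step_gen h. Qed.

Lemma preserves_dir (T : Type) (c : T -> bitseq) (R : rel T) d :
  preserves c R -> preserves c (dir d R).
Proof.
case: d => // h x x' y y' xx yy; have [h1 h2] := h _ _ _ _ xx yy.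
by split=> // z z' zz; rewrite (h2 _ _ zz).
Qed.

Section Embedding.

Variables (Y Z : coded_system) (f : Y -> Z).
Hypothesis fE : sys_emb f.

Lemma emb_cl x y z : cl (f x) (f y) (f z) = cl x y z.
Proof. by case: fE. Qed.

Lemma emb_same e x y : same (f e) (f x) (f y) = same e x y.
Proof. by rewrite !sameE !emb_cl. Qed.

Lemma emb_step e x y : step e x y -> step (f e) (f x) (f y).
Proof.
case/orP=> [h|/existsP[b h]]; apply/orP; first by rewrite emb_same; left.
right; apply/existsP; exists b; case: fE => _ _ fg.
by case/orP: h => /fg->; rewrite ?orbT.
Qed.

Lemma emb_connect e x y : connect (step e) x y ->
  connect (step (f e)) (f x) (f y).
Proof.
move=> /connectP[p xp ->]; elim: p x xp => [|z p IH] x /=.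
  by move=> _; apply: connect0.
by case/andP=> /emb_step/connect1 xz /IH; apply: connect_trans.
Qed.

End Embedding.

(** A generator fixing [e] acts on the branch points between [e] and the root as a partial order
    automorphism. *)
Lemma cl_gen (Y : coded_system) b d (e x x' y y' : Y) :
  gen b e e -> dir d (gen b) x x' -> dir d (gen b) y y' ->
  cl e x y = cl e x' y'.
Proof.
move=> ee xx yy; have ee' : dir d (gen b) e e by case: d {xx yy}.
by have [_ h] := preserves_dir (d := d) (@gen_pres Y b) ee' xx; apply: h yy.
Qed.

(* Extends a generator, or its inverse, at [x] by a new leaf just above the
   level of [v]. *)
Lemma extend (Y : coded_system) (e x v : Y) (b d : bool) :
  gen b e e ->
  (forall z w, dir d (gen b) z w ->
     cl e z x && ~~ cl e v w || cl e x z && cl e v w) ->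
  exists (Y' : coded_system) (j : Y -> Y') (n : Y'),
    [/\ sys_emb j, (forall y', y' = n \/ exists y, y' = j y),
        dir d (gen b) (j x) n,
        (forall z w, gen (~~ b) z w ->
           exists z0 w0, [/\ z = j z0, w = j w0 & gen (~~ b) z0 w0])
      & forall y, cl (j e) (j y) n = ~~ cl e v y
               /\ cl (j e) n (j y) = cl e v y].
Proof.
move=> ee H.
(* The new leaf is put on the same side of [e] as [x]. *)
have [c [c_inj c_size c_lt c_cl [c_e c_n]]] :=
  new_leaf e v (before e x) (@code_inj Y) (@code_size Y).
pose R b' : rel (option Y) := fun z w =>
  if (z, w) is (Some z, Some w) then gen b' z w else false.
have pR b' : preserves c (R b').
  move=> [z|] [z'|] [w|] [w'|] //= zz ww; rewrite !c_lt.
  have [h1 h2] := gen_pres zz ww; split=> // [[y|] [y'|] //= yy].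
  by rewrite !c_cl (h2 _ _ yy).
pose R' := [rel z w | dir d (R b) z w || (z == Some x) && (w == None)].
have pR' : preserves c R'.
  apply: (@preserves_add _ (width Y).+2 c (dir d (R b)) (Some e)) => //.
  - exact: preserves_dir.
  - by rewrite /dir /=; case: d {H R'}.
  - by rewrite c_lt c_e.
  move=> [z|] [w|] zw; try by case: (d) zw.
  have {}zw : dir d (gen b) z w by case: (d) zw.
  (* Domain points nearer than [x] have images up to the level of [v], those further have images
     beyond it; the new leaf sits in this gap. *)
  have [-> ->] := c_n w; rewrite !c_cl; have := H _ _ zw.
  rewrite -!/(cl _ _ _) !clE; split; lia.
(* Only the generator [b] changes; a second [dir d] turns the extended map back. *)
pose g b' : rel (option Y) := if b' == b then dir d R' else R b'.
have pg b' : preserves c (g b').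
  by rewrite /g; case: eqP => _; [apply: preserves_dir|].
exists (CodedSystem c_inj c_size pg), Some, None; split.
- split=> [y z|y z t|b' y z yz] /=.
  + by rewrite /before /= c_lt.
  + by rewrite /cl /= c_cl.
  + rewrite /g; case: eqP => // eb; subst b'.
    by rewrite /R' /R /dir /=; case: (d) => /=; rewrite yz.
- by case=> [y|]; [right; exists y|left].
- by rewrite /= /g eqxx /R' /dir /=; case: (d); rewrite /= !eqxx ?orbT.
- move=> [z|] [w|]; rewrite /= /g; have -> : (~~ b == b) = false by case: (b).
  + by exists z, w.
  + by [].
  + by [].
  + by [].
- by move=> y; rewrite /cl; exact: c_n.
Qed.

(** * Extensions that cannot be amalgamated *)

(** The number of these points decreases in the induction of [splits_moved]. *)
Definition above_orbit (Y : coded_system) (e a : Y) : {set Y} :=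
  [set y | [forall x, connect (step e) a x ==> cl e x y]].

(** New points lie in the orbit, so they are not above it; old points above the new orbit were above
    the old one, and [w] is lost. *)
Lemma above_orbit_shrinks (Y Z : coded_system) (f : Y -> Z) (e a w : Y) :
  sys_emb f ->
  (forall z, connect (step (f e)) (f a) z \/ exists y, z = f y) ->
  w \in above_orbit e a -> f w \notin above_orbit (f e) (f a) ->
  #|above_orbit (f e) (f a)| < #|above_orbit e a|.
Proof.
move=> fE onto wa fw; rewrite [X in _ < X](cardsD1 w) wa add1n ltnS.
apply: leq_trans (leq_imset_card f _); apply: subset_leq_card.
apply/subsetP => z zA; have [az|[y zy]] := onto z.
  by move: zA; rewrite inE => /forallP/(_ z); rewrite az clE ltnn.
rewrite zy in zA *; apply: imset_f; rewrite !inE; apply/andP; split.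
  by apply: contraNneq fw => <-.
apply/forallP => x; apply/implyP => ax; move: zA; rewrite inE.
by move=> /forallP/(_ (f x)); rewrite (emb_connect fE ax) (emb_cl fE).
Qed.

Definition splits (Y : coded_system) (e a : Y) : Prop :=
  exists (Y1 Y2 : coded_system) (f1 : Y -> Y1) (f2 : Y -> Y2),
    [/\ sys_emb f1, sys_emb f2
      & forall (W : coded_system) (g1 : Y1 -> W) (g2 : Y2 -> W),
          sys_emb g1 -> sys_emb g2 ->
          g1 (f1 e) = g2 (f2 e) -> g1 (f1 a) <> g2 (f2 a)].

(** Allows [Y] to be enlarged before the two extensions are chosen. *)
Lemma splits_emb (Y Z : coded_system) (f : Y -> Z) (e a : Y) :
  sys_emb f -> splits (f e) (f a) -> splits e a.
Proof.
move=> fE [Y1 [Y2 [f1 [f2 [E1 E2 H]]]]].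
by exists Y1, Y2, (f1 \o f), (f2 \o f); split=> //; apply: sys_emb_comp.
Qed.

(* [b] may fix [n] or move it up. Levels of orbit points are determined by
   words in the generators, so the two choices cannot be amalgamated. *)
Lemma splits_free (Y : coded_system) (e a n : Y) (b : bool) :
  (forall b, gen b e e) -> connect (step e) a n ->
  (forall z w, gen b z w -> [/\ cl e z n = cl e w n, cl e n z = ~~ cl e z n
     & cl e n w = ~~ cl e w n]) ->
  splits e a.
Proof.
move=> ee an H.
(* First extension: [b] fixes [n]. *)
pose fixn : rel Y := [rel z w | gen b z w || (z == n) && (w == n)].
pose g b' : rel Y := if b' == b then fixn else gen b'.
have pg b' : preserves (@code Y) (g b').
  rewrite /g; case: eqP => _; last exact: gen_pres.
  apply: (preserves_add (@code_inj Y) (@code_size Y) (@gen_pres Y b) (ee b)) => //.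
pose Y1 := CodedSystem (@code_inj Y) (@code_size Y) pg.
(* Second extension: [b] moves [n] to a new leaf just above [n]. *)
have [|Y2 [j [n' [jE _ jn _ jl]]]] := @extend Y e n n b true (ee b).
  by move=> z w /H[]; case: (cl e z n) => <- -> ->.
exists Y1, Y2, (id : Y -> Y1), j; split=> //.
  split=> // b' x y xy; rewrite /= /g; case: eqP => // eb; subst b'.
  by rewrite /fixn /= xy.
move=> W g1 g2 E1 E2 ge ga; pose eW := g1 e.
have E1' : sys_emb (g1 : Y -> W).
  case: E1 => h1 h2 h3; split=> // b' x y xy; apply: h3; rewrite /= /g.
  by case: eqP => // eb; subst b'; rewrite /fixn /= xy.
have E2' := sys_emb_comp jE E2.
have eeW b' : gen b' eW eW by case: E1' => _ _; apply.
have gsame b' x y x' y' : gen b' x x' -> gen b' y y' -> same eW x y = same eW x' y'.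
  by move=> xx yy; rewrite !sameE (@cl_gen W b' true eW x x' y y') //
    (@cl_gen W b' true eW y y' x x').
(* Points whose two images in [W] have the same level; the set is closed under [step] and contains
   [a], hence [n]. *)
pose P := [pred u | same eW (g1 u) (g2 (j u))].
have closedP : closed (step e) P.
  apply: (intro_closed (@step_csym Y e)) => u w uw; rewrite !inE => Pu.
  case/orP: uw => [uw|/existsP[b' /orP[uw|wu]]].
  - have h1 : same eW (g1 u) (g1 w) by rewrite (emb_same E1').
    have h2 : same eW (g2 (j u)) (g2 (j w)).
      by have := emb_same E2' e u w; rewrite uw /= -ge.
    by move: Pu h1 h2; rewrite /same => /eqP -> /eqP <- /eqP ->.
  - rewrite -(gsame b' (g1 u) (g2 (j u))) //.
      by case: E1' => _ _; apply.
    by case: E2' => _ _ h; apply: h.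
  - rewrite (gsame b' _ _ (g1 u) (g2 (j u))) //.
      by case: E1' => _ _; apply.
    by case: E2' => _ _ h; apply: h.
have Pn : P n.
  have : n \in P by rewrite -(closed_connect closedP an) inE /= /same ga.
  by [].
(* In [W] the generator [b] fixes one image of [n] and sends the other to the image of [n']; so [n']
   would have the level of [n], not one above it. *)
have n1 : gen b (g1 n) (g1 n).
  by case: E1 => _ _; apply; rewrite /= /g eqxx /fixn /= !eqxx orbT.
have n2 : gen b (g2 (j n)) (g2 n') by case: E2 => _ _; apply.
move: (Pn); rewrite /= (gsame b _ _ _ _ n1 n2) => Pn'.
have : cl e n n = false by rewrite clE ltnn.
have [h _] := jl n; rewrite -[cl e n n]negbK -h -(emb_cl E2) -ge -/eW clE.
by move: Pn Pn'; rewrite /= /same => /eqP <- /eqP->; rewrite ltnn.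
Qed.

Lemma cl_trans (Y : coded_system) (e x y z : Y) :
  cl e x y -> cl e y z -> cl e x z.
Proof. by rewrite !clE => xy yz; apply: ltn_trans yz xy. Qed.

Lemma cl_ntrans (Y : coded_system) (e x y z : Y) :
  cl e x y -> ~~ cl e z y -> cl e x z.
Proof. by rewrite !clE -leqNgt => xy zy; apply: leq_ltn_trans zy xy. Qed.

(** Otherwise the top level of the orbit would be closed under [step] and contain both [a] and
    [a']. *)
Lemma edge_into_top (Y : coded_system) (e a a' x : Y) :
  connect (step e) a a' -> ~~ same e a a' -> connect (step e) a x ->
  (forall y, connect (step e) a y -> ~~ cl e x y) ->
  exists b d y z, [/\ dir d (gen b) y z, connect (step e) a y, same e x z
    & cl e y x].
Proof.
move=> aa' naa' ax xmax.
have [/existsP[b]|N] := boolP [exists b, exists d, exists y, exists z,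
  [&& dir d (gen b) y z, connect (step e) a y, same e x z & cl e y x]].
  move=> /existsP[d /existsP[y /existsP[z /and4P[]]]].
  by exists b, d, y, z.
suff closedL : closed (step e) (same e x).
  have xa := closed_connect closedL.
  have xL : x \in same e x by rewrite /in_mem /= /same.
  have aL : a \in same e x by rewrite (xa _ _ ax).
  have a'L : a' \in same e x by rewrite -(xa _ _ aa').
  by move: naa' aL a'L; rewrite /in_mem /= /same => /negP h /eqP h1 /eqP h2;
     case: h; rewrite -h1 -h2.
apply: (intro_closed (@step_csym Y e)) => u w uw; rewrite /in_mem /= => xu.
have au : connect (step e) a u.
  apply: (connect_trans ax); apply: connect1.
  by rewrite /step xu.
have aw : connect (step e) a w := connect_trans au (connect1 uw).
case/orP: uw => [uw|/existsP[b uw]].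
  by move: xu uw; rewrite /same => /eqP->.
apply: contraNT N => xw; apply/existsP; exists b; apply/existsP.
exists (gen b w u); apply/existsP; exists w; apply/existsP; exists u.
rewrite aw xu; have := xmax _ aw; move: xw.
rewrite /same !clE => h1 h2.
apply/and4P; split=> //; last by rewrite ltn_neqAle h1 leqNgt.
by move: uw; rewrite /dir; case: (gen b w u); rewrite ?orbF.
Qed.

(** Induction on the number of points above the orbit: the orbit is extended upward until
    [splits_free] applies. *)
Lemma splits_moved (Y : coded_system) (e a a' : Y) :
  (forall b, gen b e e) -> connect (step e) a a' -> ~~ same e a a' ->
  splits e a.
Proof.
have [m] := ubnP #|above_orbit e a|.
elim: m Y e a a' => // m IH Y e a a'; rewrite ltnS => Ym ee aa' naa'.
(* Levels are lengths of meets, so the highest one has minimal value. *)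
have [x0 ax0 x0max] := arg_minnP (level e) (connect0 (step e) a).
have x0top y : connect (step e) a y -> ~~ cl e x0 y.
  by move=> /x0max; rewrite clE -leqNgt.
have [b [d [y [x [yx ay x0x yx0]]]]] := edge_into_top aa' naa' ax0 x0top.
have ax : connect (step e) a x.
  by apply: (connect_trans ax0); apply: connect1; rewrite /step x0x.
have xtop u : connect (step e) a u -> ~~ cl e x u.
  by move=> /x0top; rewrite !clE; move: x0x; rewrite /same => /eqP->.
have ybx : cl e y x by move: yx0 x0x; rewrite !clE /same => h /eqP<-.
(* [n] will be put just above [v], the highest among [x] and the images of points below [x]. *)
pose Q v := (v == x) || [exists z, dir d (gen b) z v && cl e z x].
have Qx : Q x by rewrite /Q eqxx.
have [v Qv vmin] := arg_minnP (level e) Qx.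
have eed : dir d (gen b) e e by case: (d); apply: ee.
(* As [y] goes up to [x], a point not below [x] goes above [x]. It cannot be at the level of [x],
   since its image would be an orbit point above the top. *)
have top_move z w : dir d (gen b) z w -> ~~ cl e z x -> cl e x z && cl e x w.
  move=> zw zx.
  have xw : cl e x w.
    by rewrite -(cl_gen (ee b) yx zw); apply: cl_ntrans ybx zx.
  rewrite xw andbT; apply/negPn/negP => xz.
  have xz' : same e x z by rewrite sameE xz.
  have /xtop/negP[] // : connect (step e) a w.
  apply: (connect_trans ax); apply: (@connect_trans _ _ z); apply: connect1.
    by rewrite /step xz'.
  exact: step_dir zw.
have [|Y1 [j [n [jE onto xn jF jl]]]] := @extend Y e x v b d (ee b).
  move=> z w zw; have [zx|zx] := boolP (cl e z x).
    apply/orP; left; rewrite /= clE -leqNgt; apply: vmin.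
    by apply/orP; right; apply/existsP; exists z; rewrite zw.
  have /andP[xz xw] := top_move z w zw zx; apply/orP; right; rewrite xz /=.
  case/orP: Qv => [/eqP->//|/existsP[z0 /andP[z0v z0x]]].
  by rewrite -(cl_gen (ee b) z0v zw); apply: cl_trans z0x xz.
have jee b' : gen b' (j e) (j e) by case: jE => _ _; apply; apply: ee.
have an : connect (step (j e)) (j a) n.
  apply: connect_trans (emb_connect jE ax) (connect1 _).
  exact: step_dir xn.
have jaa' := emb_connect jE aa'.
have jnaa' : ~~ same (j e) (j a) (j a') by rewrite (emb_same jE).
have nlev z w : gen (~~ b) z w ->
    cl (j e) n z = ~~ cl (j e) z n /\ cl (j e) n w = ~~ cl (j e) w n.
  move=> /jF[z0 [w0 [-> -> _]]].
  by have [-> ->] := jl z0; have [-> ->] := jl w0; rewrite !negbK.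
apply: (splits_emb jE).
(* The other generator is undefined at [n]. If it never crosses the level of [n], both fixing [n]
   and moving it up are possible. *)
have [good|] := boolP [forall z, forall w,
    gen (~~ b) z w ==> (cl (j e) z n == cl (j e) w n)].
  apply: (splits_free (n := n) (b := ~~ b)) => // z w zw.
  have [h1 h2] := nlev _ _ zw; split=> //.
  by move/forallP/(_ z)/forallP/(_ w): good; rewrite zw => /eqP.
rewrite negb_forall => /existsP[z1]; rewrite negb_forall => /existsP[w1].
rewrite negb_imply => /andP[zw1 ne1].
(* The direction is chosen so that a point below [n] goes above [n]. *)
have [d' [z [w [zw zn nw]]]] : exists d' z w,
    [/\ dir d' (gen (~~ b)) z w, cl (j e) z n & cl (j e) n w].
  have [h1 h2] := nlev _ _ zw1.
  case: (boolP (cl (j e) z1 n)) ne1 h1 => hz;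
    case: (boolP (cl (j e) w1 n)) h2 => hw //= h2 _ h1.
    by exists true, z1, w1; rewrite h2.
  by exists false, w1, z1; rewrite h1.
(* [n] is sent just above [v2], the highest image of a point below [n], which is at least as high as
   [w]. *)
pose Q2 v2 := [exists z2, dir d' (gen (~~ b)) z2 v2 && cl (j e) z2 n].
have Q2w : Q2 w by apply/existsP; exists z; rewrite zw.
have [v2 /existsP[z2 /andP[zv2 z2n]] v2min] := arg_minnP (level (j e)) Q2w.
have [|Y2 [j2 [n2 [j2E onto2 nn2 _ j2l]]]] := @extend Y1 (j e) n v2 (~~ b) d' (jee _).
  move=> z3 w3 zw3; have [z3n|z3n] := boolP (cl (j e) z3 n).
    apply/orP; left; rewrite /= clE -leqNgt; apply: v2min.
    by apply/existsP; exists z3; rewrite zw3.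
  have nz3 : cl (j e) n z3.
    have [/nlev[h _]|/nlev[_ h]] : gen (~~ b) z3 w3 \/ gen (~~ b) w3 z3.
    - by case: (d') zw3; [left|right].
    - by rewrite h.
    - by rewrite h.
  apply/orP; right; rewrite nz3 /= -(cl_gen (jee _) zv2 zw3).
  exact: cl_trans z2n nz3.
have an2 : connect (step (j2 (j e))) (j2 (j a)) n2.
  apply: connect_trans (emb_connect j2E an) (connect1 _).
  exact: step_dir nn2.
apply: (splits_emb j2E); apply: (IH _ _ _ (j2 (j a'))).
(* [w] comes from a point of [Y] above the whole orbit; now [n2] belongs to the orbit and lies above
   it. *)
- have [w0 jw0] : exists w0, w = j w0.
    case: (onto w) => // wn; move: nw; rewrite wn clE ltnn //.
  apply: leq_trans Ym.
  apply: (@above_orbit_shrinks _ _ (j2 \o j) e a w0); first exact: sys_emb_comp.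
  + move=> y'; case: (onto2 y') => [->|[y1 ->]]; first by left.
    case: (onto y1) => [->|[y0 ->]]; last by right; exists y0.
    by left; apply: emb_connect.
  + rewrite inE; apply/forallP => u; apply/implyP => /xtop xu.
    have [_ h] := jl w0; move: nw; rewrite jw0 h.
    move: xu; rewrite !clE -leqNgt => xu.
    by move=> h1; apply: leq_trans h1 (leq_trans (vmin _ Qx) xu).
  + rewrite inE; apply/negP => /forallP/(_ n2); rewrite /= an2 /=.
    rewrite -jw0; have [_ ->] := j2l w.
    by rewrite clE ltnNge (v2min _ Q2w).
- by move=> b'; case: j2E => _ _; apply.
- exact: emb_connect.
- by rewrite (emb_same j2E).
Qed.

(** * Failure of weak amalgamation *)

Section Coding.

Variables (A B : ostruct) (k l : nat) (c : A -> bitseq) (d : B -> bitseq).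
Hypotheses (cA : coding k c) (dB : coding l d).

(** Follows from [closerE]; a relation [R] covers embeddings as well as partial automorphisms. *)
Lemma coding_closer (R : A -> B -> Prop) :
  (forall x y x' y', R x x' -> R y y' -> (olt x y <-> olt x' y')) ->
  (forall x y z x' y' z', R x x' -> R y y' -> R z z' ->
     (S3 x y z <-> S3 x' y' z')) ->
  forall x y z x' y' z', R x x' -> R y y' -> R z z' ->
    ltb (c x) (c y) = ltb (d x') (d y') /\
    closer (c x) (c y) (c z) = closer (d x') (d y') (d z').
Proof.
case: cA => _ c_size cO cS _; case: dB => _ d_size dO dS _ RO RS.
have lt x y x' y' : R x x' -> R y y' -> ltb (c x) (c y) = ltb (d x') (d y').
  move=> xx yy; have [h1 h2] := RO _ _ _ _ xx yy.
  by apply/idP/idP => [/cO/h1/dO|/dO/h2/cO].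
have sp x y z x' y' z' : R x x' -> R y y' -> R z z' ->
    sep (c x) (c y) (c z) = sep (d x') (d y') (d z').
  move=> xx yy zz; have [h1 h2] := RS _ _ _ _ _ _ xx yy zz.
  by apply/idP/idP => [/cS/h1/dS|/dS/h2/cS].
move=> x y z x' y' z' xx yy zz; split; first exact: lt.
by rewrite !closerE ?c_size ?d_size // (sp x y z x' y' z') //
  (sp z x y z' x' y') // (sp z y x z' y' x') // (lt z x z' x') //
  (lt z y z' y').
Qed.

Lemma emb_coding (f : A -> B) :
  (forall x y, ltb (d (f x)) (d (f y)) = ltb (c x) (c y)) ->
  (forall x y z, closer (d (f x)) (d (f y)) (d (f z)) =
                 closer (c x) (c y) (c z)) ->
  o_embedding f.
Proof.
case: cA => c_inj c_size cO cS cR; case: dB => d_inj d_size dO dS dR f_lt f_cl.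
have f_inj : injective f.
  move=> x y fxy; apply: c_inj; apply/eqP/negPn/negP => xy.
  have : size (c x) = size (c y) by rewrite !c_size.
  by move/ltbC=> /(_ xy); rewrite -!f_lt fxy ltbss.
split=> [|x y z|x y]; last by rewrite cO dO f_lt.
  split=> // x y z t; rewrite cR dR /quartet !f_cl /= !inE.
  by rewrite !(inj_eq c_inj) !(inj_eq d_inj) !(inj_eq f_inj).
by rewrite cS dS /sep !f_lt !f_cl.
Qed.

Lemma coding_emb (f : A -> B) : o_embedding f ->
  (forall x y, ltb (d (f x)) (d (f y)) = ltb (c x) (c y)) /\
  (forall x y z, closer (d (f x)) (d (f y)) (d (f z)) =
                 closer (c x) (c y) (c z)).
Proof.
case=> _ fS fO.
have h x y z : ltb (c x) (c y) = ltb (d (f x)) (d (f y)) /\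
    closer (c x) (c y) (c z) = closer (d (f x)) (d (f y)) (d (f z)).
  apply: (@coding_closer (fun x x' => x' = f x)) => //.
    by move=> ? ? ? ? -> ->.
  by move=> ? ? ? ? ? ? -> -> ->.
by split=> [x y|x y z]; [have [->] := h x y x|have [_ ->] := h x y z].
Qed.

End Coding.

Lemma partial_aut_preserves (A : ostruct) k (c : A -> bitseq)
    (p : A -> option A) :
  coding k c -> partial_aut p -> preserves c (fun x y => p x == Some y).
Proof.
move=> cA [_ _ pS pO].
have h : forall x y z x' y' z',
    p x = Some x' -> p y = Some y' -> p z = Some z' ->
    ltb (c x) (c y) = ltb (c x') (c y') /\
    closer (c x) (c y) (c z) = closer (c x') (c y') (c z').
  apply: (@coding_closer A A k k c c cA cA (fun x y => p x = Some y)).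
    by move=> *; apply: pO.
  by move=> *; apply: pS.
move=> x x' y y' /eqP xx /eqP yy; split=> [|z z' /eqP zz].
  by have [] := h _ _ _ _ _ _ xx yy xx.
by have [] := h _ _ _ _ _ _ xx yy zz.
Qed.

(** * Passing between [SB2] and coded systems *)

Definition sb_gen (X : SB2) (b : bool) : rel X :=
  fun x y => (if b then sb_p x else sb_q x) == Some y.

Lemma sb_gen_preserves (X : SB2) k (c : X -> bitseq) (b : bool) :
  coding k c -> preserves c (@sb_gen X b).
Proof.
move=> cX; case: b.
  exact: partial_aut_preserves cX (@sb_p_aut X).
exact: partial_aut_preserves cX (@sb_q_aut X).
Qed.

Lemma coding_inj (A : ostruct) k (c : A -> bitseq) : coding k c -> injective c.
Proof. by case. Qed.

Lemma coding_size (A : ostruct) k (c : A -> bitseq) :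
  coding k c -> forall x, size (c x) = k.
Proof. by case. Qed.

Definition system_of (X : SB2) k (c : X -> bitseq) (cX : coding k.+1 c) :
    coded_system :=
  @CodedSystem X k c (coding_inj cX) (coding_size cX) (@sb_gen X)
    (fun b => @sb_gen_preserves X _ c b cX).

Definition coded (Y : coded_system) : ostruct := @OStruct
  (@RStruct Y (fun x y z t => quartet (code x) (code y) (code z) (code t)))
  (fun x y z => sep (code x) (code y) (code z))
  (fun x y => ltb (code x) (code y)).

Lemma coded_coding (Y : coded_system) :
  @coding (coded Y) (width Y).+1 (@code Y).
Proof. by split=> // [|x]; [exact: code_inj|exact: code_size]. Qed.

Definition gen_fun (Y : coded_system) (b : bool) (x : coded Y) :
  option (coded Y) := [pick y | gen b x y].

(** Equality is incomparability in the order, which a generator preserves both ways. *)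
Lemma gen_eq (Y : coded_system) b (x y x' y' : Y) :
  gen b x x' -> gen b y y' -> (x == y) = (x' == y').
Proof.
move=> xx yy; have [h1 _] := gen_pres xx yy; have [h2 _] := gen_pres yy xx.
have E (u v : Y) : (u == v) = ~~ ltb (code u) (code v) && ~~ ltb (code v) (code u).
  have [->|uv] := eqVneq u v; first by rewrite ltbss.
  have cuv : code u != code v by rewrite (inj_eq (@code_inj Y)).
  by rewrite (ltbC _ cuv) ?code_size // negbK andbN.
by rewrite !E h1 h2.
Qed.

Lemma gen_funP (Y : coded_system) b (x y : Y) :
  gen_fun b x = Some y <-> gen b x y.
Proof.
rewrite /gen_fun; split; first by case: pickP => // z xz [<-].
case: pickP => [z xz xy|/(_ y)->//].
by congr Some; apply/eqP; rewrite -(gen_eq xz xy).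
Qed.

Lemma gen_partial_aut (Y : coded_system) (b : bool) : partial_aut (@gen_fun Y b).
Proof.
split=> [x y x'|x y z t x' y' z' t'|x y z x' y' z'|x y x' y'].
- by move=> /gen_funP xx /gen_funP yx; apply/eqP; rewrite (gen_eq xx yx).
- move=> /gen_funP xx /gen_funP yy /gen_funP zz /gen_funP tt /=.
  have [_ hxy] := gen_pres xx yy; have [_ hzt] := gen_pres zz tt.
  rewrite /quartet (hxy _ _ zz) (hxy _ _ tt) (hzt _ _ xx) (hzt _ _ yy).
  rewrite /= !inE !(inj_eq (@code_inj Y)).
  rewrite (gen_eq xx yy) (gen_eq xx zz) (gen_eq xx tt).
  by rewrite (gen_eq yy zz) (gen_eq yy tt) (gen_eq zz tt).
- move=> /gen_funP xx /gen_funP yy /gen_funP zz /=; rewrite /sep.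
  have [h1 h2] := gen_pres yy xx; have [-> _] := gen_pres xx zz.
  by have [-> _] := gen_pres yy zz; rewrite (h2 _ _ zz).
- by move=> /gen_funP xx /gen_funP yy /=; have [->] := gen_pres xx yy.
Qed.

Section SystemSB2.

Variables (Y : coded_system) (y0 : Y).

Lemma coded_ordered : ordered_boron_tree (coded Y).
Proof.
apply: coding_ordered (@coded_coding Y).
by apply/card_gt0P; exists y0.
Qed.

Definition system_SB2 : SB2 := @MkSB2 (coded Y) (@gen_fun Y true)
  (@gen_fun Y false) coded_ordered (@gen_partial_aut Y true)
  (@gen_partial_aut Y false).

End SystemSB2.

Lemma sys_emb_of (Y : coded_system) (y0 : Y) (Z : SB2) l (d : Z -> bitseq)
    (dZ : coding l.+1 d) (f : Y -> Z) :
  @SB2_embedding (system_SB2 y0) Z f -> @sys_emb Y (system_of dZ) f.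
Proof.
case=> fO fp fq; have [f_lt f_cl] := coding_emb (@coded_coding Y) dZ fO.
split=> //; case=> x y /gen_funP xy; apply/eqP.
  exact: fp.
exact: fq.
Qed.

Lemma SB2_embedding_of (X : SB2) k (c : X -> bitseq) (cX : coding k.+1 c)
    (Y : coded_system) (y0 : Y) (f : X -> Y) :
  @sys_emb (system_of cX) Y f -> @SB2_embedding X (system_SB2 y0) f.
Proof.
case=> f_lt f_cl f_gen; split.
- exact: (emb_coding cX (@coded_coding Y)).
- by move=> x x' /eqP xx; apply/gen_funP/(f_gen true).
- by move=> x x' /eqP xx; apply/gen_funP/(f_gen false).
Qed.

(** * The structure without a suitable extension *)

(** [None], [Some false], [Some true] are e < a < b, and the first bit gives the branching (ea)b. *)
Definition seed_code (x : option bool) : bitseq :=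
  match x with
  | None => [:: false; false]
  | Some false => [:: false; true]
  | Some true => [:: true; false]
  end.

(** Both generators fix e; only p, the case [b = true], sends a to b. *)
Definition seed_gen (b : bool) : rel (option bool) := fun x y =>
  match x, y with
  | None, None => true
  | Some false, Some true => b
  | _, _ => false
  end.

Lemma seed_code_inj : injective seed_code.
Proof. by move=> [[]|] [[]|]. Qed.

Lemma seed_code_size x : size (seed_code x) = 2.
Proof. by move: x => [[]|]. Qed.

Lemma seed_gen_preserves b : preserves seed_code (seed_gen b).
Proof.
by move=> [[]|] [[]|] [[]|] [[]|] //= _ _; split=> // -[[]|] [[]|].
Qed.

Definition seed : coded_system :=
  CodedSystem seed_code_inj seed_code_size seed_gen_preserves.

Theorem theorem4p4 : ~ @WAP SB2 (fun X : SB2 => X) (@SB2_embedding).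
Proof.
move=> /(_ (@system_SB2 seed None))[X [phi [phiE amalg]]].
have [k [c cX]] := ordered_coding (phi None) (sb_ordered X).
have phiS : @sys_emb seed (system_of cX) phi := sys_emb_of cX phiE.
have phi_gen b x y : seed_gen b x y -> sb_gen b (phi x) (phi y).
  by case: phiS => _ _; apply.
(* In [X] too, the images of a and b are joined by p and have different levels. *)
have [|||Y1 [Y2 [f1 [f2 [f1E f2E H]]]]] :=
  @splits_moved (system_of cX) (phi None) (phi (Some false)) (phi (Some true)).
- by move=> b; apply: phi_gen.
- by apply/connect1/(step_gen _ (b := true)); apply: phi_gen.
- by rewrite (emb_same phiS).
(* An amalgam of the two extensions of [X] would agree at e and a, which [H] forbids. *)
have [W [g1 [g2 [g1E g2E g12]]]] := amalg _ _ _ _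
  (SB2_embedding_of (f1 (phi None)) f1E) (SB2_embedding_of (f2 (phi None)) f2E).
have [l [d dW]] := ordered_coding (g1 (f1 (phi None))) (sb_ordered W).
exact: (H _ _ _ (sys_emb_of dW g1E) (sys_emb_of dW g2E) (g12 None)
  (g12 (Some false))).
Qed.
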